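(* Let $\mu$ be a nonnegative Borel measure on $\mathbb{R}^+$ with $\mu(\mathbb{R}^+)\in(0,\infty)$, let $Z$ be a real-valued $\alpha$-stable L\'evy process with $\alpha\in(0,2)$ that is not a pure drift process, and let $f:\mathbb{R}\to\mathbb{R}$ be locally Lipschitz continuous with $\lim_{x\to\infty}f(x)=\infty$. Suppose there is $\phi\in C^1(\mathbb{R}^+;(0,\infty))$ such that $\lim_{x\to\infty}\phi(x)=\infty$, $\phi'(x)>0$ for all $x$, $\phi'(x)\downarrow 0$ as $x\to\infty$ (that is, $\phi'$ tends to zero monotonically), and $$\lim_{x\to\infty}\frac{f(x)}{\phi(x)}=1,\qquad\lim_{|x|\to\infty}\frac{|f(x)|}{\phi(|x|)}=1.$$ Let $X$ be the unique strong (c\`adl\`ag) solution of $$X(t)=X(0)+\int_0^t m(t-s)f(X(s))\,ds+Z(t),\quad t\ge0,\qquad m(t)=\mu([0,t]).$$ Let $\gamma\in C((0,\infty);(0,\infty))$ be an increasing function such that the limit $$L_f(\gamma):=\lim_{t\to\infty}\frac{\gamma(t)}{\mu(\mathbb{R}^+)\int_0^t f(\gamma(s))\,ds}$$ exists and $L_f(\gamma)\in(1,\infty]$. If $\int_0^\infty\gamma(s)^{-\alpha}\,ds<\infty$, then $$\limsup_{t\to\infty}\frac{|X(t)|}{\gamma(t)}\le\frac{1}{L_f(\gamma)}\quad\text{a.s.},$$ where $1/L_f(\gamma)$ is interpreted as $0$ if $L_f(\gamma)=\infty$. If $\int_0^\infty\gamma(s)^{-\alpha}\,ds=\infty$, then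 $$\limsup_{t\to\infty}\frac{|X(t)|}{\gamma(t)}=\infty\quad\text{a.s.}$$
   Context: $\mathbb{R}^+=[0,\infty)$. The underlying filtered probability space is complete with right-continuous filtration, $Z$ is a L\'evy process with respect to it with $Z(0)=0$, and $X(0)$ is a real-valued $\mathcal{F}_0$-measurable initial value. A L\'evy process with characteristic exponent $\Psi$ (i.e. $\mathbb{E}[e^{i\lambda Z(t)}]=e^{-t\Psi(\lambda)}$) is called $\alpha$-stable if $\Psi(k\lambda)=k^\alpha\Psi(\lambda)$ for every $k>0$ and $\lambda\in\mathbb{R}$.
   Formalization: In the divergent half the condition is taken as divergence of ∫_a^∞ γ(s)^{-α} ds for some a>0 instead of ∫_0^∞, since divergence only at 0 (e.g. γ(t)=t³, α=1) makes the claim false; the convergent half is stated for every lower limit a≥0. *)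

(* Defs.v *)
From HB Require Import structures.
From mathcomp Require Import all_boot all_order all_algebra.
From mathcomp Require Import all_classical all_reals all_analysis.
From mathcomp Require Export complex.

Set Implicit Arguments.
Unset Strict Implicit.
Unset Printing Implicit Defensive.

Import Order.TTheory GRing.Theory Num.Theory.
Import numFieldNormedType.Exports.

Local Open Scope classical_set_scope.
Local Open Scope ring_scope.

(* Processes and filtrations are indexed by the whole of R; only their values
   at times t >= 0 matter. *)

Definition usual_filtration d (Omega : measurableType d) (R : realType)
    (P : probability Omega R) (F : R -> set (set Omega)) :=
  [/\ (forall t : R, 0 <= t -> sigma_algebra setT (F t) /\ F t `<=` measurable),
      (forall s t : R, 0 <= s -> s <= t -> F s `<=` F t),
      (* completeness of the filtration; since F 0 consists of measurable
         sets, it also makes the probability space complete *)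
      (forall N : set Omega, P.-negligible N -> F 0 N) &
      (forall t : R, 0 <= t -> \bigcap_(s in `]t, +oo[) F s `<=` F t)].

Definition measurable_wrt (Omega : Type) (R : realType)
    (G : set (set Omega)) (Y : Omega -> R) :=
  forall B : set (measurableTypeR R), measurable B -> G (Y @^-1` B).

Definition adapted (Omega : Type) (R : realType)
    (F : R -> set (set Omega)) (X : R -> Omega -> R) :=
  forall t : R, 0 <= t -> measurable_wrt (F t) (X t).

Definition cadlag (R : realType) (g : R -> R) :=
  (forall t : R, 0 <= t -> g s @[s --> t^'+] --> g t) /\
  (forall t : R, 0 < t -> cvg (g s @[s --> t^'-])).

Definition increment (Omega : Type) (R : realType) (Z : R -> Omega -> R)
    (s t : R) : Omega -> R := fun w => Z t w - Z s w.

(* Levy process relative to F. Stochastic continuity is not listed: it follows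
   from cadlag paths and stationarity of the increments. *)
Definition levy_process d (Omega : measurableType d) (R : realType)
    (P : probability Omega R) (F : R -> set (set Omega))
    (Z : R -> Omega -> R) :=
  [/\ adapted F Z,
      (\forall w \ae P, Z 0 w = 0 /\ cadlag (Z ^~ w)),
      (forall s t : R, 0 <= s -> s <= t ->
        forall (A : set Omega) (B : set (measurableTypeR R)),
        F s A -> measurable B ->
        P (A `&` increment Z s t @^-1` B) = (P A * P (increment Z s t @^-1` B))%E) &
      (forall s t : R, 0 <= s -> s <= t -> forall B : set (measurableTypeR R),
        measurable B ->
        P (increment Z s t @^-1` B) = P (increment Z 0 (t - s) @^-1` B))].

Definition cexp (R : realType) (z : R[i]) : R[i] :=
  ((expR (complex.Re z))%:C * (cos (complex.Im z) +i* sin (complex.Im z)))%C.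

(* E[exp(i lambda Y)] *)
Definition charfun d (Omega : measurableType d) (R : realType)
    (P : probability Omega R) (Y : Omega -> R) (lambda : R) : R[i] :=
  (fine ('E_P[(fun w => cos (lambda * Y w))])
   +i* fine ('E_P[(fun w => sin (lambda * Y w))]))%C.

Definition char_exponent d (Omega : measurableType d) (R : realType)
    (P : probability Omega R) (Z : R -> Omega -> R) (Psi : R -> R[i]) :=
  forall t lambda : R, 0 <= t ->
    charfun P (Z t) lambda = cexp (- (t%:C)%C * Psi lambda).

Definition alpha_stable d (Omega : measurableType d) (R : realType)
    (P : probability Omega R) (alpha : R) (Z : R -> Omega -> R) :=
  exists2 Psi, char_exponent P Z Psi &
    forall k lambda : R, 0 < k ->
      Psi (k * lambda) = ((k `^ alpha)%:C)%C * Psi lambda.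

Definition pure_drift d (Omega : measurableType d) (R : realType)
    (P : probability Omega R) (Z : R -> Omega -> R) :=
  exists b : R, \forall w \ae P, forall t : R, 0 <= t -> Z t w = b * t.

Definition locally_lipschitz (R : realType) (f : R -> R) :=
  forall x : R, exists2 U : set R, nbhs x U & [lipschitz f y | y in U].

(* phi is C^1 on [0, +oo[ with derivative dphi, one-sided at 0. *)
Definition C1_Rplus (R : realType) (phi dphi : R -> R) :=
  (forall x : R, 0 <= x ->
    (phi y - phi x) / (y - x) @[y --> within `[0, +oo[ x^'] --> dphi x) /\
  {within `[0, +oo[, continuous dphi}.

Definition kernel_m (R : realType)
    (mu : {measure set (measurableTypeR R) -> \bar R}) (t : R) : R :=
  fine (mu `[0, t]%classic).

Definition strong_solution d (Omega : measurableType d) (R : realType)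
    (P : probability Omega R) (F : R -> set (set Omega))
    (mu : {measure set (measurableTypeR R) -> \bar R}) (f : R -> R)
    (X0 : Omega -> R) (Z X : R -> Omega -> R) :=
  [/\ adapted F X,
      (\forall w \ae P, cadlag (X ^~ w)) &
      (\forall w \ae P, forall t : R, 0 <= t ->
        X t w = X0 w
          + \int[lebesgue_measure]_(s in `[0, t])
              (kernel_m mu (t - s) * f (X s w))
          + Z t w)].

(* Main.v *)
(* A path that is small compared with gamma, in the sense Z = o(gamma), forces
   X = O(gamma): by concavity of phi, a bound |X| <= B gamma with B >= 1 gives
   |f(X)| <= (1 + o(1)) B f(gamma) + O(1), and inserting this in the equation
   improves B to (1 / L + o(1)) B. Iterating down to B = 1, one last application
   yields the limsup bound 1 / L.
   Conversely, X = O(gamma) forces Z(n+1) - Z(n) = O(gamma(n+1)), because the total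
   variation of the kernel m is finite and f has at most linear growth.
   It remains to decide when Z = o(gamma) and when the unit increments of Z are
   not O(gamma). The characteristic function of a nondegenerate stable process
   gives P(|Z(t)| >= x) <= C t x^(-alpha) and P(|Z(1)| >= x) >= c x^(-alpha) for
   large x; then Ottaviani's inequality on dyadic blocks and the two
   Borel-Cantelli arguments separate the cases according to the integral of
   gamma^(-alpha). *)

Require Import Defs.
From HB Require Import structures.
From mathcomp Require Import all_boot all_order all_algebra.
From mathcomp Require Import all_classical all_reals all_analysis.
From mathcomp Require Import measurable_realfun.
From mathcomp Require Import ring lra.

Import Order.TTheory GRing.Theory Num.Theory.
Import numFieldNormedType.Exports.

Local Open Scope classical_set_scope.
Local Open Scope ring_scope.

Set Implicit Arguments.
Unset Strict Implicit.
Unset Printing Implicit Defensive.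

(** * Cadlag paths *)

(** The iteration stops at 1 because [phi (B * y) <= B * phi y] is available for [B >= 1] only. The
    additive errors in the bound on f(X) integrate to O(t), so they are harmless only if t =
    o(gamma(t)); this holds because f(gamma) tends to infinity while its integral is at most a
    multiple of gamma. On the probabilistic side everything is read off the exponent
    [l^alpha (a + i b)], l > 0. The crux is a > 0: if a = 0, then Z(t) is almost surely a fixed
    multiple of t, and right-continuity makes Z a pure drift. With a > 0, the mean of 1 - cos(l
    Z(t)) is of order t l^alpha for small l, and trigonometric inequalities turn this into tail
    bounds, without densities or the Levy measure. Unit increments serve in the divergent case for
    two reasons: they are independent, and a unit increment of the convolution is controlled by sup
    |f(X)| alone, whereas the convolution itself may be of order t sup |f(X)|. *)

Section cadlag_paths.
Context (R : realType) (g : R -> R).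
Hypothesis cg : cadlag g.

Lemma cadlag_right (p e : R) : 0 <= p -> 0 < e ->
  exists2 d, 0 < d & forall y, p <= y < p + d -> `|g y - g p| < e.
Proof.
move=> p0 e0; have [/(_ p p0) /cvgrPdist_lt/(_ e e0)] := cg.
rewrite near_withinE => -[d /= d0 hd] _; exists d => // y /andP[].
rewrite le_eqVlt => /predU1P[<- _|py ypd]; first by rewrite subrr normr0.
rewrite distrC; apply: hd => //=.
by rewrite ltr_distlC; apply/andP; split; lra.
Qed.

(** Otherwise points where [|g|] exceeds every n would cluster somewhere in [[0, t]], but the
    one-sided limits bound [g] near each point. *)
Lemma cadlag_bounded (t : R) : exists D, forall s, 0 <= s <= t -> `|g s| <= D.
Proof.
apply: contrapT => nb.
have /choice[s hs] : forall n : nat, exists s, 0 <= s <= t /\ n%:R < `|g s|.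
  move=> n; apply: contrapT => nn; apply: nb; exists n%:R => s st.
  by rewrite leNgt; apply/negP => ns; apply: nn; exists s.
have [|p [+ cp]] := @segment_compact R 0 t (s @ \oo) _.
  by exists 0%N => // n _; rewrite /= in_itv/=; have [] := hs n.
rewrite /= in_itv/= => /andP[p0 pt].
have [d d0 hd] := cadlag_right p0 ltr01.
(* Nothing is known at negative times, so the local bound is restricted to [0 <= y], and at [p = 0]
   only the right limit is used. *)
have [D hD] : exists D, \forall y \near p, 0 <= y -> `|g y| <= D.
  have [p00|pn0] := eqVneq p 0.
    exists (`|g p| + 1); near=> y => y0.
    have : `|g y - g p| < 1.
      apply: hd; rewrite {1}p00 y0/=; near: y; apply: lt_nbhsl; lra.
    by have := ler_normD (g y - g p) (g p); rewrite subrK; lra.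
  have pp : 0 < p by rewrite lt_def pn0.
  have [_ /(_ p pp) /cvg_ex[l /cvgrPdist_lt/(_ 1 ltr01)]] := cg.
  rewrite near_withinE => hl.
  exists (`|g p| + `|l| + 1); near=> y => y0.
  have ypd : y < p + d by near: y; apply: lt_nbhsl; lra.
  have [py|yp] := leP p y.
    have : `|g y - g p| < 1 by apply: hd; rewrite py.
    have := ler_normD (g y - g p) (g p); rewrite subrK; have := normr_ge0 l; lra.
  have : `|l - g y| < 1 by move: yp; near: y.
  rewrite distrC.
  have := ler_normD (g y - l) l; rewrite subrK; have := normr_ge0 (g p); lra.
have [|y [[n /= nN ny] yD]] := cp (s @` [set n | `|D| < n%:R]) _ _ hD.
  exists (Num.truncn `|D|).+1 => // n /= Dn; exists n => //=.
  by rewrite (lt_le_trans (truncnS_gt _))// ler_nat.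
have [/andP[s0 _] ns] := hs n.
move: yD; rewrite -ny => /(_ s0); have := ler_norm D; lra.
Unshelve. all: by end_near. Qed.

(** Sampling [g] at [r n s], the first point of the grid of mesh 1/(n+1) strictly after [s], gives
    step functions that converge to [g] by right-continuity. *)
Lemma cadlag_measurable : measurable_fun `[(0 : R), +oo[ g.
Proof.
pose r n (s : R) : R := (Num.truncn (s * n.+1%:R)).+1%:R / n.+1%:R.
apply: (@measurable_fun_cvg _ _ _ _ (fun n s => g (r n s))).
  move=> n _ B mB.
  have -> : `[(0 : R), +oo[ `&` (fun s => g (r n s)) @^-1` B =
     \bigcup_(k in [set k : nat | B (g (k.+1%:R / n.+1%:R))])
        `[(k%:R / n.+1%:R : R), k.+1%:R / n.+1%:R[%classic.
    apply/seteqP; split => [s /= []|s [k /= hk]]; rewrite !in_itv/= ?andbT.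
      move=> s0 Bs; exists (Num.truncn (s * n.+1%:R)) => //=.
      rewrite in_itv/= ler_pdivrMr// ltr_pdivlMr//.
      by apply: truncn_itv; rewrite mulr_ge0.
    rewrite ler_pdivrMr// ltr_pdivlMr// => hs.
    have s0 : 0 <= s.
      by case/andP : hs => + _; rewrite -ler_pdivrMr//; apply: le_trans; rewrite divr_ge0.
    by split => //; rewrite /r (truncn_def hs).
  by apply: bigcup_measurable => k _; exact: measurable_itv.
move=> s /=; rewrite in_itv/= andbT => s0.
apply/cvgrPdist_lt => e e0; have [d d0 hd] := cadlag_right s0 e0.
near=> n; rewrite distrC; apply: hd.
have /andP[h1 h2] : (Num.truncn (s * n.+1%:R))%:R <= s * n.+1%:R < (Num.truncn (s * n.+1%:R)).+1%:R.
  by apply: truncn_itv; rewrite mulr_ge0.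
rewrite /r ler_pdivlMr// ltW//=.
have : n.+1%:R^-1 < d by near: n; exact: near_infty_natSinv_lt (PosNum d0).
move=> nd; rewrite ltr_pdivrMr// mulrDl.
rewrite -natr1 ler_ltD// -ltr_pdivrMr// mul1r//.
Unshelve. all: by end_near. Qed.

End cadlag_paths.

(** * The nonlinearity *)

Lemma C1_Rplus_is_derive (R : realType) (phi dphi : R -> R) (x : R) :
  C1_Rplus phi dphi -> 0 < x -> is_derive x (1 : R) phi (dphi x).
Proof.
move=> [hd _] x0; have := hd x (ltW x0).
have nx : nbhs x `[0, +oo[%classic.
  apply: filterS (lt_nbhsr x0) => y /= /ltW y0; by rewrite in_itv /= y0.
have -> : within `[0, +oo[%classic (x^') = x^'.
  rewrite eqEsubset; split => A; last exact: cvg_within.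
  rewrite /within/= => hA; have : (x^') (`[0, +oo[%classic : set R).
    exact: cvg_within nx.
  by apply: filterS2 hA => y /= + y0; apply.
move=> h.
suff hh : h^-1 *: ((phi \o shift x) (h *: (1 : R)) - phi x) @[h --> 0^'] --> dphi x.
  by apply: DeriveDef; [apply/cvg_ex; exists (dphi x)|apply/cvg_lim].
apply/cvgrPdist_lt => e e0; move/cvgrPdist_lt : h => /(_ e e0).
rewrite !near_withinE !near_simpl (@nbhs0P R R^o); apply: filterS => z hz z0.
have := hz; rewrite -subr_eq0 [x + z]addrC addrK => /(_ z0).
by rewrite /= /GRing.scale/= mulr1 [_ / z]mulrC.
Qed.

Lemma locally_lipschitz_continuous (R : realType) (f : R -> R) :
  locally_lipschitz f -> continuous f.
Proof.
move=> hflip x; have [U nU [k [_ hk]]] := hflip x.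
(* The Lipschitz bound holds for every constant above [k]; this one is also positive. *)
have {hk} := hk (`|k| + 1) (ltr_pwDr ltr01 (ler_norm k)).
set K := `|k| + 1 => hK; have K0 : 0 < K by rewrite ltr_wpDl.
apply/cvgrPdist_le => e e0; near=> y.
have := hK (x, y); rewrite /= => /(_ _) /le_trans; apply.
  split; first exact: nbhs_singleton.
  by near: y.
rewrite mulrC -ler_pdivlMr//; near: y.
by apply: (@cvgr_dist_le _ _ _ _ _ id); [exact: cvg_id|rewrite divr_gt0].
Unshelve. all: by end_near. Qed.

Section concave_comparison.
Context (R : realType) (phi dphi : R -> R).
Hypothesis hphi : C1_Rplus phi dphi.
Hypothesis phi_gt0 : forall x : R, 0 <= x -> 0 < phi x.
Hypothesis dphi_gt0 : forall x : R, 0 <= x -> 0 < dphi x.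
Hypothesis dphi_ni : forall x y : R, 0 <= x -> x <= y -> dphi y <= dphi x.

Let phi_MVT (a b : R) : 0 < a -> a < b ->
  exists2 c, a < c < b & phi b - phi a = dphi c * (b - a).
Proof.
move=> a0 ab; have [||c] := @MVT R phi dphi a b ab.
- move=> x; rewrite in_itv/= => /andP[ax _].
  exact: C1_Rplus_is_derive hphi (lt_trans a0 ax).
- apply: derivable_within_continuous => x; rewrite in_itv/= => /andP[ax _].
  by case: (C1_Rplus_is_derive hphi (lt_le_trans a0 ax)).
by rewrite in_itv/= => acb E; exists c.
Qed.

Lemma C1_Rplus_nd (x y : R) : 0 < x -> x <= y -> phi x <= phi y.
Proof.
move=> x0; rewrite le_eqVlt => /predU1P[->//|xy].
have [c /andP[xc cy] E] := phi_MVT x0 xy.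
rewrite -subr_ge0 E mulr_ge0 ?subr_ge0 ?(ltW xy)// ltW// dphi_gt0//.
by rewrite ltW// (lt_trans x0).
Qed.

(** The increment from [x] to [k * x] is [(k - 1) * x * dphi c] with [c > x], and
    [x * dphi c <= phi x] because [dphi] is at least [dphi c] before [x] and [phi] is positive at
    the start. *)
Lemma concave_scale (k x : R) : 1 <= k -> 0 < x -> phi (k * x) <= k * phi x.
Proof.
rewrite le_eqVlt => /predU1P[<-|k1] x0; first by rewrite !mul1r.
have xkx : x < k * x by rewrite ltr_pMl.
have [c /andP[xc ckx] E] := phi_MVT x0 xkx.
suff h : dphi c * x <= phi x.
  have -> : phi (k * x) = phi x + dphi c * (k * x - x) by rewrite -E addrC subrK.
  have -> : dphi c * (k * x - x) = (k - 1) * (dphi c * x) by ring.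
  have : (k - 1) * (dphi c * x) <= (k - 1) * phi x.
    by rewrite ler_pM2l ?subr_gt0.
  lra.
apply/ler_addgt0Pr => e e0.
have dc0 : 0 < dphi c by rewrite dphi_gt0 // ltW// (lt_trans x0).
(* [a] stands in for the endpoint 0, where only a one-sided derivative exists; the second term keeps
   the loss [a * dphi c] below [e]. *)
pose a := Num.min (x / 2) (e / dphi c).
have a0 : 0 < a by rewrite lt_min !divr_gt0.
have ax : a < x by rewrite gt_min; apply/orP; left; lra.
have ae : a * dphi c <= e.
  by rewrite -ler_pdivlMr// ge_min lexx orbT.
have [c' /andP[ac' c'x] E'] := phi_MVT a0 ax.
have : dphi c * (x - a) <= dphi c' * (x - a).
  by rewrite ler_pM2r ?subr_gt0// dphi_ni// ?(ltW (lt_trans a0 _))// ltW// (lt_trans c'x).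
have := phi_gt0 (ltW a0); move: ae; rewrite mulrC -E' mulrBr; lra.
Qed.

(** Linear growth of [phi]; the shift by 1 keeps the scaling factor at least 1. *)
Lemma concave_affine (x : R) : 0 <= x -> phi (1 + x) <= (1 + x) * phi 1.
Proof. by move=> x0; rewrite -{1}[1 + x]mulr1 concave_scale// lerDl. Qed.

Context (f : R -> R).
Hypothesis hflip : locally_lipschitz f.
Hypothesis hfphi_p : `|f x| / phi `|x| @[x --> +oo] --> (1 : R).
Hypothesis hfphi_n : `|f x| / phi `|x| @[x --> -oo] --> (1 : R).

(** Outside [[-D, D]] the ratio of [|f|] to [phi] is at most [1 + e]; inside, [C] is the maximum of
    [|f|]. The separate [y] lets a bound on [|x|], such as a multiple of [gamma], be inserted
    directly, by monotonicity of [phi]. *)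
Lemma growth_bound (e : R) : 0 < e -> exists2 C : R, 0 <= C &
  forall x y : R, 0 < y -> `|x| <= y -> `|f x| <= (1 + e) * phi y + C.
Proof.
move=> e0.
have [A [_ hA]] : \forall x \near +oo, `|f x| / phi `|x| <= 1 + e.
  by apply: cvgr_le hfphi_p _ _; rewrite ltrDl.
have [B [_ hB]] : \forall x \near -oo, `|f x| / phi `|x| <= 1 + e.
  by apply: cvgr_le hfphi_n _ _; rewrite ltrDl.
pose D := `|A| + `|B| + 1.
have D0 : 0 < D by rewrite ltr_wpDl// addr_ge0.
have DA : A < D by rewrite /D; have := ler_norm A; have := normr_ge0 B; lra.
have DB : - D < B.
  rewrite /D; have := ler_norm (- B); rewrite normrN; have := normr_ge0 A; lra.
have [||c _ hc] := @EVT_max R (fun x => `|f x|) (- D) D.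
- by rewrite -subr_ge0 opprK addr_ge0// ltW.
- apply: continuous_subspaceT => x; apply: continuous_comp.
    exact: locally_lipschitz_continuous hflip _.
  exact: norm_continuous.
exists `|f c| => // x y y0 xy.
have py : 0 <= (1 + e) * phi y by rewrite mulr_ge0// ?(ltW (phi_gt0 _)) ?(ltW y0)//; lra.
have [xD|] := leP `|x| D.
  by rewrite (le_trans (hc x _)) ?lerDr// in_itv/= -ler_norml.
rewrite ltr_normr => Dx; rewrite -[leLHS]addr0 lerD//.
have x0 : 0 < `|x|.
  by case/orP : Dx => Dx; rewrite normr_gt0; apply/eqP => x0; move: Dx D0; rewrite x0; lra.
have : `|f x| / phi `|x| <= 1 + e.
  by case/orP : Dx => Dx; [apply: hA|apply: hB]; lra.
rewrite ler_pdivrMr ?phi_gt0// => /le_trans; apply.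
by rewrite ler_wpM2l ?C1_Rplus_nd//; lra.
Qed.
End concave_comparison.

(** * Pathwise estimates *)

Lemma integrable_of_bounded (R : realType) (D : set R) (h : R -> R) (C : R) :
  measurable D -> (lebesgue_measure D < +oo)%E -> measurable_fun D h ->
  (forall x, D x -> `|h x| <= C) ->
  lebesgue_measure.-integrable D (EFin \o h).
Proof.
move=> mD fD mh hC; apply: measurable_bounded_integrable => //.
exists C; split; first exact: num_real.
by move=> x Cx y Dy; apply: le_trans (hC y Dy) (ltW Cx).
Qed.

Lemma Rintegral_itv_cst (R : realType) (a b c : R) : a <= b ->
  \int[lebesgue_measure]_(s in `]a, b]) c = c * (b - a).
Proof.
move=> ab; rewrite Rintegral_cst//= lebesgue_measure_itv/= lte_fin.
by move: ab; rewrite le_eqVlt => /predU1P[<-|->]; rewrite ?ltxx ?subrr.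
Qed.

(** * Upper estimate for the Volterra equation with a small perturbation *)

Section volterra.
Context (R : realType) (M : R) (m f phi gamma : R -> R).
Hypothesis m_nd : {homo m : x y / x <= y}.
Hypothesis m_ge0 : forall x, 0 <= m x.
Hypothesis m_leM : forall x, m x <= M.
Hypothesis f_cont : continuous f.
Hypothesis phi_gt0 : forall x : R, 0 <= x -> 0 < phi x.
Hypothesis phi_scale : forall k x : R, 1 <= k -> 0 < x -> phi (k * x) <= k * phi x.
Hypothesis f_growth : forall e : R, 0 < e -> exists2 C : R, 0 <= C &
  forall x y : R, 0 < y -> `|x| <= y -> `|f x| <= (1 + e) * phi y + C.
Hypothesis gamma_cont : {within `]0, +oo[, continuous gamma}.
Hypothesis gamma_gt0 : forall t : R, 0 < t -> 0 < gamma t.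
Hypothesis gamma_nd : forall s t : R, 0 < s -> s <= t -> gamma s <= gamma t.

Let I (t : R) := \int[lebesgue_measure]_(s in `]0, t]) f (gamma s).

Lemma measurable_kernel (D : set R) t : measurable_fun D (fun s => m (t - s)).
Proof.
apply: measurable_funTS; apply: measurableT_comp.
  exact: nondecreasing_measurable.
exact: measurable_funB.
Qed.

Lemma measurable_gamma t : measurable_fun `](0 : R), t] gamma.
Proof.
apply: (@measurable_funS _ _ _ _ `](0 : R), +oo[%classic) => //.
  by move=> s /=; rewrite !in_itv/= => /andP[-> _].
exact: subspace_continuous_measurable_fun.
Qed.

Lemma integrable_f_gamma t :
  lebesgue_measure.-integrable `]0, t] (fun s => (f (gamma s))%:E).
Proof.
have [C C0 hC] := f_growth ltr01.
apply: (@integrable_of_bounded _ _ _ ((1 + 1) * phi (gamma t) + C)) => //=.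
- rewrite lebesgue_measure_itv/=; case: ifP => // _; exact: ltry.
- apply: measurableT_comp; first exact: continuous_measurable_fun.
  exact: measurable_gamma.
- move=> s; rewrite in_itv/= => /andP[s0 st].
  apply: hC; first by rewrite gamma_gt0// (lt_le_trans s0).
  by rewrite ger0_norm ?gamma_nd// ltW// gamma_gt0.
Qed.

(** The equation integrates over [[0, t]], but [gamma] is controlled at positive times only, so the
    null set {0} is dropped here. *)
Lemma kernel_integral_le (t : R) (g h : R -> R) :
  measurable_fun `]0, t] g ->
  lebesgue_measure.-integrable `]0, t] (EFin \o h) ->
  (forall s, 0 < s <= t -> M * `|g s| <= h s) ->
  `|\int[lebesgue_measure]_(s in `[0, t]) (m (t - s) * g s)|
    <= \int[lebesgue_measure]_(s in `]0, t]) h s.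
Proof.
move=> mg ih gh.
have ig : lebesgue_measure.-integrable `]0, t] (EFin \o (fun s => m (t - s) * g s)).
  apply: le_integrable ih => //.
    apply/measurable_EFinP; apply: measurable_funM => //; exact: measurable_kernel.
  move=> s; rewrite /= in_itv/= => st; rewrite lee_fin.
  rewrite (le_trans _ (ler_norm _))// (le_trans _ (gh s st))// normrM.
  by rewrite ler_wpM2r// ger0_norm.
rewrite -Rintegral_itv_obnd_cbnd//.
apply: (le_trans (le_normr_Rintegral _ ig)) => //.
apply: le_Rintegral => //.
  by move: (integrable_abse ig).
move=> s; rewrite /= in_itv/= => st.
by rewrite (le_trans _ (gh s st))// normrM ler_wpM2r// ger0_norm.
Qed.

Hypothesis gamma_oo : gamma t @[t --> +oo] --> +oo.
Hypothesis f_oo : f x @[x --> +oo] --> +oo.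
Hypothesis f_phi : f x / phi x @[x --> +oo] --> (1 : R).

Lemma M_ge0 : 0 <= M. Proof. exact: le_trans (m_ge0 0) (m_leM 0). Qed.

(** Returns from [phi] to [f] along [gamma], where the one-sided limit of [f / phi] applies because
    [gamma] tends to infinity. *)
Lemma phi_gamma_le (e : R) : 0 < e -> exists T0, forall s, T0 <= s ->
  phi (gamma s) <= (1 + e) * f (gamma s).
Proof.
move=> e0; have [Y [_ hY]] : \forall x \near +oo, (1 + e)^-1 <= f x / phi x.
  by apply: cvgr_ge f_phi _ _; rewrite invf_lt1; lra.
have [T [_ hT]] : \forall s \near +oo, `|Y| < gamma s.
  exact: (@cvgry_gt _ _ _ _ _ gamma_oo).
exists (T + 1) => s Ts.
have Yg : `|Y| < gamma s by apply: hT; lra.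
have g0 : 0 < gamma s by rewrite (le_lt_trans _ Yg).
have := hY _ (le_lt_trans (ler_norm _) Yg).
have pg : 0 < phi (gamma s) by exact: phi_gt0 (ltW g0).
by rewrite ler_pdivlMr// ler_pdivrMl//; lra.
Qed.

(** [f (gamma s)] may be negative at early times; adding [c] makes it nonnegative, so one majorant
    serves on all of []0, t]]. *)
Lemma f_lower_bound : exists2 c : R, 0 <= c & forall y : R, 0 <= y -> - c <= f y.
Proof.
have [C C0 hC] := f_growth ltr01.
have [Y [_ hY]] : \forall y \near +oo, 0 <= f y by exact: cvgry_ge f_oo 0.
have Y1 : 0 < `|Y| + 1 by rewrite ltr_wpDl.
exists ((1 + 1) * phi (`|Y| + 1) + C).
  by rewrite addr_ge0// mulr_ge0// ltW// phi_gt0// ltW.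
move=> y y0; have [yY|Yy] := leP y Y; last first.
  by rewrite (le_trans _ (hY y Yy))// oppr_le0 addr_ge0// mulr_ge0// ltW// phi_gt0// ltW.
have : `|f y| <= (1 + 1) * phi (`|Y| + 1) + C.
  by apply: hC => //; rewrite ger0_norm//; have := ler_norm Y; lra.
by rewrite ler_norml => /andP[].
Qed.

(** The order of the quantifiers is what matters: [C0] and [T0] depend on [e] alone, and [C] is
    chosen before [t], [B] and [x]. So the coefficient of [B] is free of [T] and [D], and the
    estimate can be iterated. *)
Lemma volterra_bound (e : R) : 0 < e ->
  exists C0 T0 : R, forall T D : R, 0 < T -> T0 <= T -> exists2 C : R, 0 <= C &
  forall (t B : R) (x : R -> R), T <= t -> 1 <= B ->
    measurable_fun `](0 : R), t] x ->
    (forall s, 0 <= s <= T -> `|x s| <= D) ->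
    (forall s, T <= s <= t -> `|x s| <= B * gamma s) ->
  `|\int[lebesgue_measure]_(s in `[0, t]) (m (t - s) * f (x s))|
    <= C * t + (1 + e) ^+ 2 * B * (M * I t + C0 * t).
Proof.
move=> e0; have [c c0 hc] := f_lower_bound.
have [C C0 hC] := f_growth e0.
have [T0 hT0] := phi_gamma_le e0.
exists (M * c), T0 => T D Tp T0T.
have D1 : 0 < `|D| + 1 by rewrite ltr_wpDl.
have := phi_gt0 (ltW D1); set pD := phi _ => pD0.
have K0 : 0 <= (1 + e) * pD + C + C by rewrite !addr_ge0// mulr_ge0//; lra.
exists (M * ((1 + e) * pD + C + C)).
  by rewrite mulr_ge0// M_ge0.
move=> t B x Tt B1 mx xD xB.
have t0 : 0 <= t by rewrite ltW// (lt_le_trans Tp).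
(* One factor [1 + e] comes from bounding [f] by [phi], the other from returning to [f] along
   [gamma]. *)
set k := (1 + e) ^+ 2 * B.
have k0 : 0 <= k by rewrite mulr_ge0 ?sqr_ge0//; lra.
pose A := M * ((1 + e) * pD + C + C) + k * (M * c).
have if1 : lebesgue_measure.-integrable `]0, t] (EFin \o (fun s => (k * M) * f (gamma s))).
  by have := integrableZl _ (k * M) (integrable_f_gamma t); apply.
have icst : lebesgue_measure.-integrable `]0, t] (EFin \o (fun _ : R => A)).
  apply: (@integrable_of_bounded _ _ _ `|A|) => //.
  by rewrite lebesgue_measure_itv/=; case: ifP => // _; exact: ltry.
apply: le_trans (kernel_integral_le (h := fun s => (k * M) * f (gamma s) + A) _ _ _) _.
- by apply: measurableT_comp mx; exact: continuous_measurable_fun.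
- have := integrableD _ if1 icst; exact.
- move=> s /andP[s0 st].
  have gs0 := gamma_gt0 s0.
  have fg : 0 <= f (gamma s) + c by have := hc _ (ltW gs0); lra.
  have -> : k * M * f (gamma s) + A =
     M * (k * (f (gamma s) + c) + ((1 + e) * pD + C + C)) by rewrite /A; ring.
  rewrite ler_wpM2l ?M_ge0//.
  have [sT|Ts] := leP s T.
    have : `|f (x s)| <= (1 + e) * pD + C.
      apply: hC => //; rewrite (le_trans (xD s _)) ?sT ?ltW//.
      by have := ler_norm D; lra.
    have : 0 <= k * (f (gamma s) + c) by rewrite mulr_ge0.
    lra.
  have xs : `|x s| <= B * gamma s by apply: xB; rewrite st ltW.
  have Bg : 0 < B * gamma s by rewrite mulr_gt0//; lra.
  have h1 := hC _ _ Bg xs.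
  have h2 : (1 + e) * phi (B * gamma s) <= k * f (gamma s).
    rewrite /k expr2 -!mulrA ler_pM2l; last lra.
    rewrite (le_trans (phi_scale B1 gs0))// mulrCA ler_pM2l; last lra.
    by apply: hT0; rewrite (le_trans T0T)// ltW.
  have h3 : 0 <= k * c by rewrite mulr_ge0.
  have h4 : 0 <= (1 + e) * pD by rewrite mulr_ge0 ?(ltW pD0)//; lra.
  rewrite mulrDr; lra.
rewrite RintegralD// RintegralZl//; last exact: integrable_f_gamma.
rewrite Rintegral_itv_cst// subr0 -/(I t) /A.
lra.
Qed.
Hypothesis M_gt0 : 0 < M.

Context (l : R).
Hypothesis l_gt1 : 1 < l.
Hypothesis I_le : \forall t \near +oo, M * I t <= l^-1 * gamma t.

(** Since [f (gamma s)] eventually exceeds any [N], [M * I t] is at least [M * N * t] up to a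
    constant, while it is at most [gamma t]. *)
Lemma near_id_le (e : R) : 0 < e -> \forall t \near +oo, t <= e * gamma t.
Proof.
(* This makes [e * M * N = 2]: of the resulting [2 * t], one [t] absorbs the constant left by the
   times before [T]. *)
move=> e0; pose N := 2 / (e * M).
have [Y [_ hY]] : \forall y \near +oo, N <= f y by exact: cvgry_ge f_oo N.
have [T1 [_ hT1]] : \forall s \near +oo, Y < gamma s by exact: (@cvgry_gt _ _ _ _ _ gamma_oo).
pose T := `|T1| + 1.
have T0 : 0 < T by rewrite ltr_wpDl.
have IT t : T <= t -> I T + N * (t - T) <= I t.
  move=> Tt; have itf := integrable_f_gamma t.
  have sub : `]T, t] `<=` `]0, t].
    by move=> s /=; rewrite !in_itv/= => /andP[Ts ->]; rewrite andbT (lt_trans T0).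
  rewrite /I -lerBrDl (@Rintegral_itvB _ (fun s => f (gamma s)) _ _ T itf); first last.
  - by rewrite bnd_simp.
  - by rewrite bnd_simp ltW.
  have -> : N * (t - T) = \int[lebesgue_measure]_(s in `]T, t]) N.
    by rewrite Rintegral_itv_cst.
  apply: le_Rintegral => //.
  - apply: (@integrable_of_bounded _ _ _ `|N|) => //.
    by rewrite lebesgue_measure_itv/=; case: ifP => // _; exact: ltry.
  - exact: integrableS itf.
  - move=> s /=; rewrite in_itv/= => /andP[Ts _]; apply: hY; apply: hT1.
    by rewrite (le_lt_trans _ Ts)// /T; have := ler_norm T1; lra.
near=> t.
have : M * I t <= l^-1 * gamma t by near: t; exact: I_le.
have tT : T <= t by near: t; apply: nbhs_pinfty_ge; exact: num_real.
have g0 : 0 < gamma t by apply: gamma_gt0; exact: lt_le_trans tT.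
have l1 : l^-1 < 1 by rewrite invf_lt1 // (lt_trans ltr01).
have h1 : M * (I T + N * (t - T)) <= M * I t by rewrite ler_wpM2l ?IT// ltW.
have h2 : l^-1 * gamma t <= gamma t by rewrite ger_pMl// ltW.
have h3 : e * M * N = 2 by rewrite /N mulrCA divff ?mulr1// mulf_neq0// gt_eqF.
have h4 : `|e * M * (I T - N * T)| <= t by near: t; apply: nbhs_pinfty_ge; exact: num_real.
move=> h5.
have : e * (M * (I T + N * (t - T))) <= e * gamma t by rewrite ler_wpM2l ?(ltW e0)//; lra.
have -> : e * (M * (I T + N * (t - T))) = e * M * (I T - N * T) + (e * M * N) * t by ring.
rewrite h3; have := ler_norm (- (e * M * (I T - N * T))); rewrite normrN; lra.
Unshelve. all: by end_near. Qed.

Lemma near_cst_le (e A : R) : 0 < e -> \forall t \near +oo, A <= e * gamma t.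
Proof.
move=> e0; have : \forall t \near +oo, A / e <= gamma t by exact: (@cvgry_ge _ _ _ _ _ gamma_oo).
by apply: filterS => t; rewrite ler_pdivrMr// mulrC.
Qed.

Context (x0 : R) (x z : R -> R).
Hypothesis x_cadlag : cadlag x.
Hypothesis xE : forall t : R, 0 <= t ->
  x t = x0 + \int[lebesgue_measure]_(s in `[0, t]) (m (t - s) * f (x s)) + z t.
Hypothesis z_small : forall e : R, 0 < e -> \forall t \near +oo, `|z t| <= e * gamma t.

Lemma pathwise_upper (q : R) : l^-1 < q < 1 -> \forall t \near +oo, `|x t| <= q * gamma t.
Proof.
move=> /andP[lq q1].
have p0 : 0 < l^-1 by rewrite invr_gt0 (lt_trans ltr01).
(* As [p < 1] and [e <= 1], [r = (1 + e)^2 (p + e)] is at most [p + 7 e], so [e + r <= q]. *)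
set p := l^-1 in lq p0 *; pose e := (q - p) / 12.
have e0 : 0 < e by rewrite /e; lra.
have [C0 [T0 vb]] := volterra_bound e0.
pose k := (1 + e) ^+ 2; pose r := k * (p + e).
have k0 : 0 < k by rewrite exprn_gt0//; lra.
have rq : e + r <= q.
  suff : r <= p + 7 * e by rewrite /e; lra.
  by rewrite /r /k; have : e <= 1 by [rewrite /e; lra]; nra.
have r0 : 0 < r by rewrite mulr_gt0//; lra.
have [T1 [T1p T01 hT1]] : exists T1, [/\ 0 < T1, T0 <= T1 & forall t, T1 <= t ->
    [/\ C0 * t <= e * gamma t, M * I t <= p * gamma t, `|z t| <= gamma t,
        t <= gamma t & 1 <= gamma t]].
  have : \forall t \near +oo, [/\ C0 * t <= e * gamma t, M * I t <= p * gamma t, `|z t| <= gamma t,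
        t <= gamma t & 1 <= gamma t].
    have c1 : 0 < e / (`|C0| + 1) by rewrite divr_gt0// ltr_wpDl.
    near=> t; split.
    - have : t <= e / (`|C0| + 1) * gamma t by near: t; apply: near_id_le.
      have t0 : 0 <= t by near: t; apply: nbhs_pinfty_ge; exact: num_real.
      rewrite mulrAC ler_pdivlMr ?ltr_wpDl// => h; apply: le_trans h.
      rewrite mulrC ler_wpM2l//; have := ler_norm C0; lra.
    - by near: t; exact: I_le.
    - by rewrite -[leRHS]mul1r; near: t; exact: z_small.
    - by rewrite -[leRHS]mul1r; near: t; exact: near_id_le.
    - by rewrite -[leRHS]mul1r; near: t; exact: near_cst_le.
  move=> [T [_ hT]]; exists (`|T| + `|T0| + 1); split.
  - by rewrite ltr_wpDl// addr_ge0.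
  - by have := ler_norm T0; have := normr_ge0 T; lra.
  - by move=> t ht; apply: hT; have := ler_norm T; have := normr_ge0 T0; lra.
have mx t : measurable_fun `](0 : R), t] x.
  apply: (measurable_funS _ _ (cadlag_measurable x_cadlag)) => //.
  by move=> s /=; rewrite !in_itv/= => /andP[/ltW ->].
(* One pass through the equation turns the factor [B] into [r * B], up to terms that are
   o(gamma). *)
have step T D : T1 <= T -> (forall s, 0 <= s <= T -> `|x s| <= D) ->
    exists2 C : R, 0 <= C & forall t B, T <= t -> 1 <= B ->
      (forall s, T <= s <= t -> `|x s| <= B * gamma s) ->
      `|x t| <= `|x0| + `|z t| + C * t + r * B * gamma t.
  move=> T1T hD; have [C C_ge0 hC] := vb T D (lt_le_trans T1p T1T) (le_trans T01 T1T).
  exists C => // t B Tt B1 hB.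
  have [h1 h2 _ _ _] := hT1 t (le_trans T1T Tt).
  rewrite xE; last by rewrite ltW// (lt_le_trans T1p)// (le_trans T1T).
  rewrite (le_trans (ler_normD _ _))//.
  have := ler_normD x0 (\int[lebesgue_measure]_(s in `[0, t]) (m (t - s) * f (x s))).
  have := hC t B x Tt B1 (mx t) hD hB; rewrite -/(I t).
  have : k * B * (M * I t + C0 * t) <= k * B * ((p + e) * gamma t).
    by rewrite ler_wpM2l ?mulr_ge0 ?(ltW k0)//; lra.
  by rewrite /r -/k; lra.
(* [S], the supremum of [|x| / gamma] on [T1, t], satisfies [S <= A + r max(1, S)]
   with [r < 1], which bounds it independently of [t]. *)
have [B0 B01 hB0] : exists2 B, 1 <= B & forall s, T1 <= s -> `|x s| <= B * gamma s.
  have [D hD] := cadlag_bounded x_cadlag T1.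
  have [C C_ge0 hC] := step T1 D (lexx _) hD.
  pose A := `|x0| + 1 + C.
  have A1 : 1 <= A by rewrite /A; have := normr_ge0 x0; lra.
  exists ((A + 1) / (1 - r)); first by rewrite ler_pdivlMr; lra.
  move=> t T1t.
  have [D' hD'] := cadlag_bounded x_cadlag t.
  pose E := [set y | exists2 s, T1 <= s <= t & y = `|x s| / gamma s].
  have g0 s : T1 <= s -> 0 < gamma s by move=> T1s; apply: gamma_gt0; lra.
  have Eub : has_ubound E.
    exists (`|D'|) => y [s /andP[T1s st] ->].
    rewrite ler_pdivrMr ?g0//.
    have [_ _ _ _ g1] := hT1 s T1s.
    rewrite (le_trans (hD' s _)) ?st ?(le_trans (ltW T1p))//.
    by rewrite (le_trans (ler_norm _))// ler_peMr.
  have E0 : E !=set0 by exists (`|x t| / gamma t); exists t => //; rewrite T1t lexx.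
  pose S := sup E.
  have xS s : T1 <= s <= t -> `|x s| <= S * gamma s.
    move=> /andP[T1s st]; rewrite -ler_pdivrMr ?g0//.
    by apply: ub_le_sup => //; exists s => //; rewrite T1s.
  pose B := Num.max 1 S.
  have B1 : 1 <= B by rewrite le_max lexx.
  have xB s : T1 <= s <= t -> `|x s| <= B * gamma s.
    move=> st; rewrite (le_trans (xS s st))// ler_wpM2r ?le_max ?lexx ?orbT//.
    by case/andP : st => /g0/ltW.
  have SB : S <= A + r * B.
    apply: ge_sup => // y [s /andP[T1s st] ->]; rewrite ler_pdivrMr ?g0//.
    have [_ _ zg sg g1] := hT1 s T1s.
    have h1 : C * s <= C * gamma s by rewrite ler_wpM2l.
    have h2 : `|x0| <= `|x0| * gamma s by rewrite ler_peMr.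
    have h3 : `|x s| <= `|x0| + `|z s| + C * s + r * B * gamma s.
      by apply: hC => // u /andP[T1u us]; apply: xB; rewrite T1u (le_trans us).
    rewrite /A.
    by lra.
  have SB' : B * (1 - r) <= A + 1.
    have : B <= A + r * B.
      rewrite /B ge_max SB andbT -/B; have : 0 <= r * B by rewrite mulr_ge0// ltW//; lra.
      lra.
    lra.
  have := xB t; rewrite T1t lexx => /(_ isT) /le_trans; apply.
  by rewrite ler_wpM2r ?(ltW (g0 _ _))// ler_pdivlMr//; lra.
(* Each of the terms [|x0|], [|z t|] and [C * t] takes a third of [e * gamma t], and
   [e + r <= q]. *)
have next T B : T1 <= T -> 1 <= B -> (forall s, T <= s -> `|x s| <= B * gamma s) ->
    exists2 T', T1 <= T' & forall s, T' <= s -> `|x s| <= q * B * gamma s.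
  move=> T1T B1 hB; have [D hD] := cadlag_bounded x_cadlag T.
  have [C C_ge0 hC] := step T D T1T hD.
  have : \forall t \near +oo, `|x t| <= q * B * gamma t.
    have e3 : 0 < e / 3 by rewrite divr_gt0.
    have eC : 0 < e / 3 / (C + 1) by rewrite divr_gt0//; lra.
    near=> t.
    have Tt : T <= t by near: t; apply: nbhs_pinfty_ge; exact: num_real.
    have g0 : 0 < gamma t by apply: gamma_gt0; lra.
    have := hC t B Tt B1; have h0 s : T <= s <= t -> `|x s| <= B * gamma s by move=> /andP[/hB].
    move=> /(_ h0).
    have h1 : `|x0| <= e / 3 * gamma t by near: t; exact: near_cst_le.
    have h2 : `|z t| <= e / 3 * gamma t by near: t; exact: z_small.
    have h3 : t <= e / 3 / (C + 1) * gamma t.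
      by near: t; exact: near_id_le.
    have h4 : C * t <= e / 3 * gamma t.
      move: h3; rewrite mulrAC ler_pdivlMr; last lra.
      by apply: le_trans; rewrite mulrDr mulr1 mulrC; lra.
    have h5 : e * gamma t <= e * B * gamma t.
      by rewrite ler_wpM2r ?(ltW g0)// ler_peMr// ltW.
    have h6 : (e + r) * B * gamma t <= q * B * gamma t.
      by rewrite ler_wpM2r ?(ltW g0)// ler_wpM2r//; lra.
    lra.
  move=> [T' [_ hT']]; exists (`|T'| + T1 + 1); first by have := normr_ge0 T'; lra.
  by move=> s hs; apply: hT'; have := ler_norm T'; lra.
(* The maximum with 1 keeps the factor in the range [1 <= B] where [next] applies. *)
have iterate n : exists2 T, T1 <= T &
    forall s, T <= s -> `|x s| <= Num.max 1 (q ^+ n * B0) * gamma s.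
  elim: n => [|n [T T1T hT]].
    exists T1 => // s T1s; rewrite expr0 mul1r (le_trans (hB0 s T1s))//.
    by rewrite ler_wpM2r ?le_max ?lexx ?orbT// ltW// gamma_gt0//; lra.
  have [|T' T1T' hT'] := next T _ T1T _ hT; first by rewrite le_max lexx.
  exists T' => // s T's; rewrite (le_trans (hT' s T's))// ler_wpM2r//.
    by rewrite ltW// gamma_gt0//; lra.
  rewrite maxr_pMr ?mulr1; last lra.
  by rewrite exprS -mulrA ge_max !le_max (ltW q1) lexx orbT.
have [n qn] : exists n, q ^+ n * B0 <= 1.
  have : geometric B0 q @ \oo --> 0 by apply: cvg_geometric; rewrite ger0_norm//; lra.
  move=> /cvgr_le/(_ 1 ltr01) [n _ /(_ n (leqnn _))]; rewrite /geometric/= mulrC => h.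
  by exists n.
have [T T1T hT] := iterate n.
have [s hs|T' T1T' hT'] := next T 1 T1T (lexx _).
  by have := hT s hs; rewrite (max_idPl qn).
by exists T'; split; [exact: num_real|move=> s /ltW /hT'; rewrite mulr1].
Unshelve. all: by end_near. Qed.
End volterra.

(** * Unit increments of the noise recovered from the solution *)

Section pathwise_increments.
Context (R : realType) (M : R) (m : R -> R).
Hypothesis m_nd : {homo m : x y / x <= y}.
Hypothesis m_ge0 : forall x, 0 <= m x.
Hypothesis m_leM : forall x, m x <= M.

Let integrable_kernel (D : set R) (t : R) (g : R -> R) (G : R) :
  measurable D -> (lebesgue_measure D < +oo)%E -> measurable_fun D g ->
  (forall s, D s -> `|g s| <= G) ->
  lebesgue_measure.-integrable D (EFin \o (fun s => m (t - s) * g s)).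
Proof.
move=> mD fD mg gG; apply: (@integrable_of_bounded _ _ _ (M * G)) => //.
  by apply: measurable_funM => //; exact: measurable_kernel.
by move=> s Ds; rewrite normrM ler_pM ?gG// ger0_norm.
Qed.

Let fin_itv (a b : itv_bound R) : a != BInfty _ true -> b != BInfty _ false ->
  (lebesgue_measure ([set` Interval a b] : set R) < +oo)%E.
Proof.
rewrite lebesgue_measure_itv/=; case: a => [? ?|[]]; case: b => [? ?|[]] //= _ _;
  by case: ifP => // _; exact: ltry.
Qed.

(* On ]k, k + 1] monotonicity bounds the integrand by
   [m (n + 1 - k) - m (n - k - 1)], and these bounds telescope. *)
Lemma kernel_variation (n : R) (k : nat) :
  \int[lebesgue_measure]_(s in `[0, k%:R]) (m (n + 1 - s) - m (n - s))
    <= m (n + 1) + m n - m (n + 1 - k%:R) - m (n - k%:R).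
Proof.
have ik (D : set R) : measurable D -> (lebesgue_measure D < +oo)%E ->
    lebesgue_measure.-integrable D (EFin \o (fun s => m (n + 1 - s) - m (n - s))).
  move=> mD fD; apply: (@integrable_of_bounded _ _ _ (M + M)) => //.
    by apply: measurable_funB; exact: measurable_kernel.
  by move=> s Ds; rewrite (le_trans (ler_normB _ _))// lerD// ger0_norm.
elim: k => [|k IH]; first by rewrite set_itv1 Rintegral_set1 !subr0; lra.
have h1 : (BLeft (0:R) <= BRight (k%:R : R))%O by rewrite bnd_simp.
have h2 : (BRight (k%:R : R) <= BRight (k.+1%:R : R))%O by rewrite bnd_simp ler_nat.
have i1 := ik _ (measurable_itv `[0, k.+1%:R]) (@fin_itv (BLeft 0) (BRight k.+1%:R) isT isT).
have E := Rintegral_itvB i1 h1 h2.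
have : \int[lebesgue_measure]_(s in `]k%:R, k.+1%:R]) (m (n + 1 - s) - m (n - s)) <=
    \int[lebesgue_measure]_(s in `]k%:R, k.+1%:R]) (m (n + 1 - k%:R) - m (n - k.+1%:R)).
  apply: le_Rintegral => //.
  - exact: ik _ (measurable_itv _) (@fin_itv (BRight k%:R) (BRight k.+1%:R) isT isT).
  - apply: (@integrable_of_bounded _ _ _ `|m (n + 1 - k%:R) - m (n - k.+1%:R)|) => //.
    exact: (@fin_itv (BRight k%:R) (BRight k.+1%:R)).
  - move=> s /=; rewrite in_itv/= => /andP[ks sk].
    by rewrite lerB// m_nd// lerD2l lerN2// ltW.
rewrite -E Rintegral_itv_cst ?ler_nat// -natr1 [X in _ * X]addrAC subrr add0r mulr1.
have -> : n + 1 - (k%:R + 1) = n - k%:R by ring.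
move: IH; lra.
Qed.

(** The new interval []n, n + 1]] contributes at most [M * G]; on [[0, n]] the change of the
    nondecreasing kernel integrates to at most [2 * M], whatever [n]. *)
Lemma kernel_increment (n : nat) (g : R -> R) (G : R) :
  measurable_fun `[(0 : R), n.+1%:R] g -> (forall s, 0 <= s <= n.+1%:R -> `|g s| <= G) ->
  `|\int[lebesgue_measure]_(s in `[0, n.+1%:R]) (m (n.+1%:R - s) * g s)
    - \int[lebesgue_measure]_(s in `[0, n%:R]) (m (n%:R - s) * g s)| <= 3 * M * G.
Proof.
move=> mg gG.
have G0 : 0 <= G by rewrite (le_trans _ (gG 0 _)) ?lexx/=.
have sub1 : `[(0:R), n%:R] `<=` `[0, n.+1%:R].
  by apply: subset_itvl; rewrite bnd_simp ler_nat.
have sub2 : `](n%:R:R), n.+1%:R] `<=` `[0, n.+1%:R].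
  by move=> s /=; rewrite !in_itv/= => /andP[/ltW ns ->]; rewrite andbT (le_trans _ ns).
have h1 : (BLeft (0:R) <= BRight (n%:R : R))%O by rewrite bnd_simp.
have h2 : (BRight (n%:R : R) <= BRight (n.+1%:R : R))%O by rewrite bnd_simp ler_nat.
have gG' s : `[(0:R), n.+1%:R]%classic s -> `|g s| <= G by rewrite /= in_itv/=; exact: gG.
have i1 := integrable_kernel n.+1%:R (measurable_itv _) (@fin_itv (BLeft 0) (BRight n.+1%:R) isT isT) mg gG'.
have mg1 : measurable_fun `[(0:R), n%:R] g by exact: measurable_funS mg.
have i2 := integrable_kernel n%:R (measurable_itv _) (@fin_itv (BLeft 0) (BRight n%:R) isT isT) mg1
  (fun s hs => gG' s (sub1 s hs)).
have i3 : lebesgue_measure.-integrable `[0, n%:R] (EFin \o (fun s => m (n.+1%:R - s) * g s)).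
  exact: integrableS i1.
have i4 : lebesgue_measure.-integrable `]n%:R, n.+1%:R] (EFin \o (fun s => m (n.+1%:R - s) * g s)).
  exact: integrableS i1.
have E := Rintegral_itvB i1 h1 h2.
pose J (t u : R) := \int[lebesgue_measure]_(s in `[0, u]) (m (t - s) * g s).
change (`|J n.+1%:R n.+1%:R - J n%:R n%:R| <= 3 * M * G).
change (J n.+1%:R n.+1%:R - J n.+1%:R n%:R =
  \int[lebesgue_measure]_(s in `]n%:R, n.+1%:R]) (m (n.+1%:R - s) * g s)) in E.
move: E; set A := J n.+1%:R n.+1%:R; set B := J n.+1%:R n%:R => E.
have -> : A - J n%:R n%:R = (A - B) + (B - J n%:R n%:R) by ring.
have hAB : `|A - B| <= M * G.
  rewrite E; apply: le_trans (le_normr_Rintegral _ i4) _ => //.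
  have -> : M * G = \int[lebesgue_measure]_(s in `]n%:R, n.+1%:R]) (M * G).
    by rewrite Rintegral_itv_cst ?ler_nat// -natr1 addrAC subrr add0r mulr1.
  apply: le_Rintegral => //.
  - exact: (integrable_abse i4).
  - apply: (@integrable_of_bounded _ _ _ `|M * G|) => //.
    exact: (@fin_itv (BRight n%:R) (BRight n.+1%:R)).
  - by move=> s hs; rewrite normrM ler_pM ?(gG' s (sub2 s hs))// ger0_norm.
have hBJ : `|B - J n%:R n%:R| <= G * (M + M).
  rewrite /B /J -RintegralB//.
  have i5 : lebesgue_measure.-integrable `[0, n%:R]
    (EFin \o (fun s => m (n.+1%:R - s) * g s - m (n%:R - s) * g s)).
    exact: (integrableB _ i3 i2).
  apply: le_trans (le_normr_Rintegral _ i5) _ => //.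
  have i6 : lebesgue_measure.-integrable `[0, n%:R]
     (EFin \o (fun s => m (n%:R + 1 - s) - m (n%:R - s))).
    apply: (@integrable_of_bounded _ _ _ (M + M)) => //.
    + exact: (@fin_itv (BLeft 0) (BRight n%:R)).
    + by apply: measurable_funB; exact: measurable_kernel.
    + by move=> s _; rewrite (le_trans (ler_normB _ _))// lerD// ger0_norm.
  apply: (@le_trans _ _ (\int[lebesgue_measure]_(s in `[0, n%:R])
      (G * (m (n%:R + 1 - s) - m (n%:R - s))))).
    apply: le_Rintegral => //.
    - exact: (integrable_abse i5).
    - by have := integrableZl _ G i6; apply.
    - move=> s hs; rewrite natr1 -mulrBl normrM mulrC ler_pM ?(gG' s (sub1 s hs))//.
      by rewrite ger0_norm// subr_ge0 m_nd// lerD2r ler_nat.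
  rewrite RintegralZl// ler_wpM2l// (le_trans (kernel_variation _ _))//.
  have := m_ge0 (n%:R + 1 - n%:R); have := m_ge0 (n%:R - n%:R).
  have := m_leM (n%:R + 1); have := m_leM n%:R; lra.
rewrite (le_trans (ler_normD _ _))//; lra.
Qed.

Context (f phi gamma : R -> R).
Hypothesis f_cont : continuous f.
Hypothesis phi1_gt0 : 0 < phi 1.
Hypothesis phi_affine : forall x : R, 0 <= x -> phi (1 + x) <= (1 + x) * phi 1.
Hypothesis f_growth : forall e : R, 0 < e -> exists2 C : R, 0 <= C &
  forall x y : R, 0 < y -> `|x| <= y -> `|f x| <= (1 + e) * phi y + C.
Hypothesis gamma_gt0 : forall t : R, 0 < t -> 0 < gamma t.
Hypothesis gamma_nd : forall s t : R, 0 < s -> s <= t -> gamma s <= gamma t.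

Context (x0 : R) (x z : R -> R).
Hypothesis x_cadlag : cadlag x.
Hypothesis xE : forall t : R, 0 <= t ->
  x t = x0 + \int[lebesgue_measure]_(s in `[0, t]) (m (t - s) * f (x s)) + z t.

Lemma pathwise_increment (K T : R) : (forall t, T <= t -> `|x t| <= K * gamma t) ->
  exists C, forall n : nat, `|z n.+1%:R - z n%:R| <= C * gamma n.+1%:R.
Proof.
move=> hK; have [C C0 hC] := f_growth ltr01.
pose c := 2 * phi 1 + C.
have fc y : `|f y| <= c * (1 + `|y|).
  have y1 : 0 < 1 + `|y| by rewrite ltr_pwDl.
  have := hC y _ y1; rewrite lerDr ler01 => /(_ isT) /le_trans; apply.
  have := phi_affine (normr_ge0 y).
  have : C * 1 <= C * (1 + `|y|) by rewrite ler_wpM2l// lerDl.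
  rewrite /c; lra.
have g1 : 0 < gamma 1 by exact: gamma_gt0.
have [D hD] := cadlag_bounded x_cadlag (`|T| + 1).
have D0 : 0 <= D by rewrite (le_trans _ (hD 0 _)) ?lexx ?addr_ge0.
(* [gamma 1 <= gamma n.+1%:R] turns the bound [D] at early times into a multiple of [gamma n.+1%:R];
   the constant 1 in [fc] is treated alike. *)
pose K' := D / gamma 1 + `|K|.
have K'0 : 0 <= K' by rewrite addr_ge0// divr_ge0// ltW.
have gn n : gamma 1 <= gamma n.+1%:R by rewrite gamma_nd// ler1n.
have xK n s : 0 <= s <= n.+1%:R -> `|x s| <= K' * gamma n.+1%:R.
  move=> /andP[s0 sn]; have gn0 := lt_le_trans g1 (gn n).
  have h1 : D <= D / gamma 1 * gamma n.+1%:R by rewrite mulrAC -mulrA ler_peMr// ler_pdivlMr// mul1r.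
  have h2 : 0 <= `|K| * gamma n.+1%:R by rewrite mulr_ge0// ltW.
  have [sT|Ts] := leP s (`|T| + 1).
    have : `|x s| <= D by apply: hD; rewrite s0 sT.
    rewrite /K'; lra.
  have Ts' : T <= s by have := ler_norm T; lra.
  have sp : 0 < s by have := normr_ge0 T; lra.
  have h3 : K * gamma s <= `|K| * gamma n.+1%:R.
    apply: (@le_trans _ _ (`|K| * gamma s)).
      by rewrite ler_wpM2r ?ler_norm// ltW// gamma_gt0.
    by rewrite ler_wpM2l// gamma_nd.
  have := hK s Ts'; rewrite /K'; lra.
pose G n := c * ((gamma 1)^-1 + K') * gamma n.+1%:R.
have c0 : 0 <= c by rewrite addr_ge0// mulr_ge0// ltW.
have fG n s : 0 <= s <= n.+1%:R -> `|f (x s)| <= G n.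
  move=> sn; rewrite (le_trans (fc _))// /G -mulrA ler_wpM2l// mulrDl lerD ?xK//.
  by rewrite mulrC ler_pdivlMr// mul1r.
exists (K' + K' + 3 * M * (c * ((gamma 1)^-1 + K'))) => n.
have mfx : measurable_fun `[(0 : R), n.+1%:R] (f \o x).
  apply: measurableT_comp; first exact: continuous_measurable_fun.
  apply: (measurable_funS _ _ (cadlag_measurable x_cadlag)) => //.
  by move=> s /=; rewrite !in_itv/= => /andP[->].
have := kernel_increment mfx (fG n).
have := xE (ler0n R n.+1); have := xE (ler0n R n).
set A := \int[lebesgue_measure]_(s in `[0, n%:R]) (m (n%:R - s) * f (x s)).
set B := \int[lebesgue_measure]_(s in `[0, n.+1%:R]) (m (n.+1%:R - s) * f (x s)).
move=> E1 E2 hAB.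
have -> : z n.+1%:R - z n%:R = x n.+1%:R - x n%:R - (B - A) by rewrite E1 E2; ring.
rewrite (le_trans (ler_normB _ _))// 2!mulrDl lerD//; last by rewrite (le_trans hAB)// /G; lra.
rewrite (le_trans (ler_normB _ _))// lerD// xK// ?ler0n ?lexx ?ler_nat//=.
Qed.
End pathwise_increments.

(** * Stable laws *)

(** Real and imaginary parts of exp(- t l^alpha (a + i b)): by scaling, the exponent on [l > 0] is
    determined by its value [a + i b] at 1. *)
Definition stable_marginals d (Omega : measurableType d) (R : realType)
    (P : probability Omega R) (alpha a b : R) (Z : R -> Omega -> R) :=
  forall t l : R, 0 <= t -> 0 < l ->
    \int[P]_w cos (l * Z t w) =
      expR (- (t * l `^ alpha * a)) * cos (t * l `^ alpha * b) /\
    \int[P]_w sin (l * Z t w) =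
      - (expR (- (t * l `^ alpha * a)) * sin (t * l `^ alpha * b)).

Section stable_charfun.
Local Open Scope complex_scope.

Let cexp_stable (R : realType) (t s : R) (p : R[i]) :
  cexp (- t%:C * (s%:C * p)) =
    (expR (- (t * s * complex.Re p)) * cos (t * s * complex.Im p))
    +i* (- (expR (- (t * s * complex.Re p)) * sin (t * s * complex.Im p))).
Proof.
case: p => a b; rewrite /cexp /=.
have -> : - t * (s * a - 0 * b) - - 0 * (s * b + 0 * a) = - (t * s * a) by ring.
have -> : - t * (s * b + 0 * a) + - 0 * (s * a - 0 * b) = - (t * s * b) by ring.
rewrite cosN sinN; apply/eqP; rewrite eq_complex /=.
by apply/andP; split; apply/eqP; ring.
Qed.

Lemma alpha_stable_marginals d (Omega : measurableType d) (R : realType)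
    (P : probability Omega R) (alpha : R) (Z : R -> Omega -> R) :
  alpha_stable P alpha Z -> exists a b : R, stable_marginals P alpha a b Z.
Proof.
move=> [Psi hPsi hs]; exists (complex.Re (Psi 1)), (complex.Im (Psi 1)) => t l t0 l0.
have := hPsi t l t0; have := hs l 1 l0; rewrite mulr1 => ->.
rewrite cexp_stable /charfun unlock => /eqP; rewrite eq_complex /=.
by move=> /andP[/eqP h1 /eqP h2].
Qed.
End stable_charfun.

Section bounded_means.
Context d (Omega : measurableType d) (R : realType) (P : probability Omega R).
Implicit Types g h : Omega -> R.

Lemma integrable_bounded_mean g (C : R) : measurable_fun setT g ->
  (forall w, `|g w| <= C) -> P.-integrable setT (EFin \o g).
Proof.
move=> mg gC; apply: measurable_bounded_integrable => //.
  by rewrite [X in (X < _)%E]probability_setT ltry.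
exists C; split; first exact: num_real.
by move=> x Cx y _; apply: le_trans (gC y) (ltW Cx).
Qed.

Lemma prob_le_mean (A : set Omega) g (C : R) : measurable A ->
  measurable_fun setT g -> (forall w, 0 <= g w <= C) ->
  (forall w, A w -> 1 <= g w) -> fine (P A) <= \int[P]_w g w.
Proof.
move=> mA mg g0C Ag.
have <- : \int[P]_w (\1_A w) = fine (P A).
  by rewrite /Rintegral integral_indic// setIT.
have ind1 w : 0 <= (\1_A w : R) <= 1 by rewrite indicE; case: (_ \in _) => /=; rewrite lexx ler01.
apply: le_Rintegral => //.
- apply: (@integrable_bounded_mean _ 1); first exact: measurable_indic.
  by move=> w; have /andP[? ?] := ind1 w; rewrite ger0_norm.
- apply: (@integrable_bounded_mean _ C) => // w.
  by have /andP[? ?] := g0C w; rewrite ger0_norm.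
- move=> w _; rewrite indicE; have [/set_mem/Ag//|_] := boolP (w \in A).
  by have /andP[] := g0C w.
Qed.

Lemma mean_cst (c : R) : \int[P]_w (cst c w) = c.
Proof. by rewrite Rintegral_cst// [X in fine X]probability_setT mulr1. Qed.

End bounded_means.

(** * Elementary bounds on 1 - cos and on the real part of the characteristic function *)

Section trig_inequalities.
Context (R : realType).
Implicit Types u : R.

Lemma cos_le0 u : pi / 2 <= u <= pi -> cos u <= 0.
Proof.
move=> /andP[hu up]; rewrite leNgt; apply/negP; rewrite -(@cos_pihalf R) ltr_cos.
- by rewrite ltNge hu.
- by rewrite in_itv/=; have := @pi_gt0 R; lra.
- by rewrite in_itv/=; have := @pi_gt0 R; lra.
Qed.

Lemma norm_sin_le u : `|sin u| <= `|u|.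
Proof.
wlog u0 : u / 0 <= u.
  move=> h; have [/h//|u0] := leP 0 u.
  by rewrite -(opprK u) sinN 2!normrN h// oppr_ge0 ltW.
have [|c _] := @MVT_segment R sin cos 0 u u0 (fun x _ => is_derive_sin x).
  by apply: derivable_within_continuous => x _; exact: derivable_sin.
rewrite sin0 2!subr0 => ->; rewrite normrM ler_piMl// cos_max//.
Qed.

Lemma one_sub_cosE u : 1 - cos u = 2 * sin (u / 2) ^+ 2.
Proof. by rewrite {1}(splitr u) cosD -!expr2 cos2sin2; ring. Qed.

Lemma one_sub_cos_ge0 u : 0 <= 1 - cos u.
Proof. by rewrite subr_ge0 cos_le1. Qed.

Lemma one_sub_cos_le2 u : 1 - cos u <= 2.
Proof. by have := cos_geN1 u; lra. Qed.

Lemma one_sub_cos_le_sqr u : 1 - cos u <= u ^+ 2 / 2.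
Proof.
rewrite one_sub_cosE -real_normK ?num_real//.
have := norm_sin_le (u / 2); have := normr_ge0 (sin (u / 2)).
move: (`|sin _|) => v v0 vu.
have : v ^+ 2 <= `|u / 2| ^+ 2 by rewrite ler_sqr ?nnegrE.
by rewrite real_normK ?num_real//; lra.
Qed.

Lemma one_sub_cos_le_norm u : 1 - cos u <= `|u|.
Proof.
rewrite one_sub_cosE -real_normK ?num_real//.
have := norm_sin_le (u / 2); have := normr_ge0 (sin (u / 2)); have := sin_max (u / 2).
rewrite normrM [`|2^-1|]ger0_norm//; move: (`|sin _|) => v v1 v0 vu.
by nra.
Qed.

Context (a b : R).
Hypothesis a_ge0 : 0 <= a.

(** With [s = t * l^alpha], the left-hand side is the mean of 1 - cos(l Z(t)). It splits into a
    defect of the exponential and one of the cosine. *)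
Lemma stable_defect_le s : 0 <= s -> 1 - expR (- (s * a)) * cos (s * b) <= (a + `|b|) * s.
Proof.
move=> s0; have h1 := expR_ge1Dx (- (s * a)).
have h2 := one_sub_cos_le_norm (s * b).
have h3 : expR (- (s * a)) * (1 - cos (s * b)) <= 1 - cos (s * b).
  by rewrite ler_piMl ?one_sub_cos_ge0// -expR0 ler_expR oppr_le0 mulr_ge0.
rewrite normrM (ger0_norm s0) in h2; lra.
Qed.

Lemma stable_defect_le_sqr s : 0 <= s ->
  1 - expR (- (s * a)) * cos (s * b) <= a * s + b ^+ 2 * s ^+ 2 / 2.
Proof.
move=> s0; have h1 := expR_ge1Dx (- (s * a)).
have h2 := one_sub_cos_le_sqr (s * b).
have h3 : expR (- (s * a)) * (1 - cos (s * b)) <= 1 - cos (s * b).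
  by rewrite ler_piMl ?one_sub_cos_ge0// -expR0 ler_expR oppr_le0 mulr_ge0.
rewrite exprMn in h2; lra.
Qed.

Lemma stable_defect_ge s : 0 <= s ->
  a * s - a ^+ 2 * s ^+ 2 <= 1 - expR (- (s * a)) * cos (s * b).
Proof.
move=> s0; have sa0 : 0 <= s * a by rewrite mulr_ge0.
have h1 := expR_ge1Dx (s * a).
have e0 := expR_gt0 (- (s * a)).
(* With [u = s * a], multiply by [1 + u <= e^u] and use [(1 + u) (1 - u + u^2) = 1 + u^3]. *)
have h2 : expR (- (s * a)) <= 1 - s * a + (s * a) ^+ 2.
  have x1 : 0 < 1 + s * a by rewrite ltr_pwDl.
  rewrite -(ler_pM2r x1); apply: (@le_trans _ _ 1).
    by rewrite -[leRHS](expRxMexpNx_1 (- (s * a))) opprK ler_wpM2l// ltW.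
  have : 0 <= (s * a) ^+ 3 by rewrite exprn_ge0.
  by rewrite !expr2 !exprS expr0; lra.
have h3 : expR (- (s * a)) * cos (s * b) <= expR (- (s * a)).
  by rewrite ler_piMr ?cos_le1// ltW.
rewrite exprMn in h2; lra.
Qed.

(** The defect is [a s + O(s^2)], so the right-hand side is [a s (4 - k) / 2] to first order. Half
    of this is kept as [c * s]; the other half absorbs the quadratic terms, whose coefficient is at
    most [B], for [s <= s0]. *)
Lemma stable_defect_comparison (k : R) : 0 < a -> 0 < k < 4 ->
  exists c s0, [/\ 0 < c, 0 < s0 & forall s, 0 <= s <= s0 ->
   c * s <= (4 - (4 - k) / 2) * (1 - expR (- (s * a)) * cos (s * b))
     - (1 - expR (- (k * s * a)) * cos (k * s * b))].
Proof.
move=> a0 /andP[k0 k4]; pose B := 4 * a ^+ 2 + b ^+ 2 * k ^+ 2 / 2.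
have B0 : 0 < B by rewrite ltr_pwDl// ?(mulr_gt0, exprn_gt0)// divr_ge0// mulr_ge0// sqr_ge0.
exists (a * (4 - k) / 4), (a * (4 - k) / 4 / B); split.
- by rewrite divr_gt0// mulr_gt0//; lra.
- by rewrite !divr_gt0// mulr_gt0//; lra.
move=> s /andP[s0]; rewrite ler_pdivlMr// => sB.
have h1 := stable_defect_ge s0.
have ks0 : 0 <= k * s by rewrite mulr_ge0// ltW.
have := stable_defect_le_sqr ks0.
rewrite exprMn => h2.
have h3 : (4 - (4 - k) / 2) * (a * s - a ^+ 2 * s ^+ 2) <=
  (4 - (4 - k) / 2) * (1 - expR (- (s * a)) * cos (s * b)) by rewrite ler_wpM2l//; lra.
have h4 : s * (s * B) <= s * (a * (4 - k) / 4) by rewrite ler_wpM2l.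
have h5 : 0 <= (4 - k) / 2 * (a ^+ 2 * s ^+ 2) by rewrite !mulr_ge0 ?sqr_ge0//; lra.
rewrite /B in h4; lra.
Qed.
End trig_inequalities.

Section powR_lemmas.
Context (R : realType).
Implicit Types x y : R.

Lemma powRV x (r : R) : 0 <= x -> x^-1 `^ r = x `^ (- r).
Proof. by move=> x0; rewrite -powR_inv1// -powRrM mulN1r. Qed.

Lemma powRX x (r : R) n : 0 <= x -> (x ^+ n) `^ r = (x `^ r) ^+ n.
Proof. by move=> x0; rewrite -(powR_mulrn n x0) powRAC powR_mulrn// powR_ge0. Qed.

Lemma powR_half_lt1 (r : R) : 0 < r -> 2^-1 `^ r < 1 :> R.
Proof.
move=> r0; rewrite -[ltRHS](_ : 1 `^ r = 1); last by rewrite powR1.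
by apply: gt0_ltr_powR => //; rewrite ?nnegrE ?invr_ge0 ?ler0n ?ler01//; lra.
Qed.
Lemma ler_powRN x y (r : R) : 0 <= r -> 0 < x -> x <= y -> y `^ (- r) <= x `^ (- r).
Proof.
move=> r0 x0 xy; have y0 := lt_le_trans x0 xy.
rewrite !powRN lef_pV2 ?posrE ?powR_gt0//.
by apply: ge0_ler_powR => //; rewrite nnegrE ltW.
Qed.

End powR_lemmas.

(** * Tail probabilities from the characteristic function *)

Section tails.
Context d (Omega : measurableType d) (R : realType) (P : probability Omega R).
Context (Y : Omega -> R) (mY : measurable_fun setT Y).

Lemma measurable_cosZ (l : R) : measurable_fun setT (fun w => cos (l * Y w)).
Proof.
apply: (measurableT_comp (f := cos)).
  by apply: continuous_measurable_fun; exact: continuous_cos.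
exact: measurable_funM.
Qed.

Lemma integrable_cosZ (l : R) : P.-integrable setT (EFin \o (fun w => cos (l * Y w))).
Proof.
apply: (@integrable_bounded_mean _ _ _ _ _ 1); first exact: measurable_cosZ.
by move=> w; exact: cos_max.
Qed.

Lemma measurable_one_sub_cosZ (l : R) : measurable_fun setT (fun w => 1 - cos (l * Y w)).
Proof. by apply: measurable_funB => //; exact: measurable_cosZ. Qed.

Lemma mean_one_sub_cos (l : R) :
  \int[P]_w (1 - cos (l * Y w)) = 1 - \int[P]_w cos (l * Y w).
Proof.
rewrite RintegralB//; last exact: integrable_cosZ.
  by congr (_ - _); exact: (mean_cst P 1).
by apply: (@integrable_bounded_mean _ _ _ _ (cst 1) `|1|).
Qed.

Lemma measurable_norm_ge (x : R) : measurable [set w | x <= `|Y w|].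
Proof.
rewrite -[X in measurable X]setTI.
have -> : [set w | x <= `|Y w|] = (fun w => `|Y w|) @^-1` `[x, +oo[.
  by apply/seteqP; split=> w /=; rewrite in_itv/= andbT.
have mN : measurable_fun setT (fun w => `|Y w|) by exact: measurableT_comp.
exact: mN.
Qed.

Lemma fine_probE (A : set Omega) : measurable A -> ((fine (P A))%:E = P A)%E.
Proof. by move=> mA; rewrite fineK// fin_num_measure. Qed.

(** The numerator comes from the frequency chosen on each dyadic shell, the denominator from the
    geometric series of ratio 2^(-alpha) over the shells. *)
Definition tail_constant (alpha : R) : R :=
  (pi / 2) `^ alpha / (1 - (2^-1) `^ alpha).

Lemma tail_constant_gt0 (alpha : R) : 0 < alpha -> 0 < tail_constant alpha.
Proof.
move=> alpha0; rewrite divr_gt0 ?powR_gt0 ?divr_gt0 ?pi_gt0// subr_gt0.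
exact: powR_half_lt1.
Qed.

(* On the shell [2^j x <= |Y| < 2^(j+1) x], the frequency pi / (2^(j+1) x) puts
   the phase in [pi / 2, pi), where [1 - cos >= 1]. *)
Lemma tail_upper (alpha c : R) : 0 < alpha -> 0 <= c ->
  (forall l : R, 0 < l -> 1 - \int[P]_w cos (l * Y w) <= c * l `^ alpha) ->
  forall x : R, 0 < x ->
  fine (P [set w | x <= `|Y w|]) <= tail_constant alpha * c * x `^ (- alpha).
Proof.
move=> alpha0 c0 hc x x0.
pose A (j : nat) := [set w | x * 2 ^+ j <= `|Y w|] `\` [set w | x * 2 ^+ j.+1 <= `|Y w|].
have mA j : measurable (A j) by apply: measurableD; exact: measurable_norm_ge.
have x2 j : 0 < x * 2 ^+ j by rewrite mulr_gt0// exprn_gt0.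
have pi0 := @pi_gt0 R.
have PA j : fine (P (A j)) <= c * ((pi / 2) `^ alpha * x `^ (- alpha)) * ((2^-1) `^ alpha) ^+ j.
  pose l := pi / 2 / (x * 2 ^+ j).
  have l0 : 0 < l by rewrite !divr_gt0.
  apply: le_trans (@prob_le_mean _ _ _ P (A j) _ 2 (mA j) (measurable_one_sub_cosZ l) _ _) _.
  - by move=> w; rewrite one_sub_cos_ge0 one_sub_cos_le2.
  - move=> w [/= h1 /negP]; rewrite -ltNge => h2.
    rewrite -cos_norm normrM (gtr0_norm l0).
    have := @cos_le0 R (l * `|Y w|); rewrite /l mulrAC ler_pdivlMr// ler_pdivrMr//.
    move=> h3; have {}h3 := h3 _; apply: le_trans (_ : 1 - 0 <= _); first by rewrite subr0.
    rewrite lerD2l lerN2 h3//; apply/andP; split.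
      by rewrite ler_pM2l ?divr_gt0.
    by rewrite -mulrA ler_pM2l//; rewrite exprS in h2; lra.
  rewrite mean_one_sub_cos (le_trans (hc l l0))// -mulrA ler_wpM2l//.
  have -> : l = pi / 2 * (x^-1 * (2^-1) ^+ j) by rewrite /l invfM exprVn.
  have V0 : 0 <= x^-1 by rewrite invr_ge0 ltW.
  have H0 : 0 <= (2^-1 : R) ^+ j by rewrite exprn_ge0.
  rewrite (@powRM _ (pi / 2)) ?mulr_ge0 ?(ltW pi0)// (powRM _ V0 H0).
  by rewrite powRX ?invr_ge0// (powRV _ (ltW x0)) mulrA.
have mX := measurable_norm_ge x.
rewrite -lee_fin fine_probE//.
have XA : [set w | x <= `|Y w|] `<=` \bigcup_j A j.
  (* The shell containing [w] is indexed by the integer binary logarithm of [|Y w| / x]. *)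
  move=> w /= xY; pose N := Num.truncn (`|Y w| / x).
  have /truncn_itv/andP[N1 N2] : 0 <= `|Y w| / x by rewrite divr_ge0// ltW.
  have N0 : (0 < N)%N.
    by rewrite -ltnS -(ltr_nat R) (le_lt_trans _ N2)// ler_pdivlMr// mul1r.
  have /andP[h1 h2] := trunc_log_bounds (ltnSn 1) N0.
  exists (trunc_log 2 N) => //=; split => /=.
    rewrite mulrC -ler_pdivlMr// (le_trans _ N1)//.
    by rewrite -natrX ler_nat.
  apply/negP; rewrite -ltNge mulrC -ltr_pdivrMr// (lt_le_trans N2)//.
  by rewrite -natrX ler_nat.
apply: le_trans (measure_sigma_subadditive P mA mX XA) _.
have r1 : (2^-1) `^ alpha < 1 :> R.
  by exact: powR_half_lt1.
apply: lime_le.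
  by apply: is_cvg_nneseries => n _ _; exact: measure_ge0.
apply: nearW => n.
have -> : (\sum_(0 <= i < n) P (A i))%E = (\sum_(0 <= i < n) fine (P (A i)))%:E.
  by rewrite -sumEFin; apply: eq_bigr => i _; rewrite fine_probE.
rewrite lee_fin.
apply: (@le_trans _ _ (series (geometric (c * ((pi / 2) `^ alpha * x `^ (- alpha)))
    ((2^-1) `^ alpha)) n)).
  by apply: ler_sum => i _; exact: PA.
apply: le_trans (geometric_le_lim _ _ _ _) _.
- by rewrite !mulr_ge0 ?powR_ge0.
- by rewrite powR_gt0.
- by rewrite ger0_norm// powR_ge0.
- by rewrite /tail_constant; lra.
Qed.

(* Since [(1 - cos u)^2 = 2 (1 - cos u) - (1 - cos (2 u)) / 2] is at most [4], and at
   most [(1 - cos u) u^2 / 2], taking means with [u = l Y] and [l = e / y] yields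
   [8 P(|Y| >= y) >= (4 - e^2) v(l) - v(2 l)], where [v l] is the mean of
   [1 - cos (l Y)]; as [v(2 l)] is about [2^alpha v(l)] with [2^alpha < 4], the
   right-hand side is positive for small [e]. *)
Lemma tail_lower (alpha a b : R) : 0 < alpha < 2 -> 0 < a ->
  (forall l : R, 0 < l -> \int[P]_w cos (l * Y w) =
     expR (- (l `^ alpha * a)) * cos (l `^ alpha * b)) ->
  exists c y0 : R, [/\ 0 < c, 0 < y0 & forall y : R, y0 <= y ->
    c * y `^ (- alpha) <= fine (P [set w | y <= `|Y w|])].
Proof.
move=> /andP[alpha0 alpha2] a0 hY; pose k : R := 2 `^ alpha.
have k0 : 0 < k by rewrite powR_gt0.
have k4 : k < 4.
  have -> : 4 = 2 `^ 2%:R :> R by rewrite powR_mulrn// expr2; lra.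
  by rewrite /k /powR pnatr_eq0/= ltr_expR ltr_pM2r ?ln_gt0//; lra.
have [|c [s0 [c0 s00 hc]]] := stable_defect_comparison b (ltW a0) a0 (k := k).
  by rewrite k0.
pose D := (4 - k) / 2; have D0 : 0 < D by rewrite divr_gt0// subr_gt0.
(* Thus [4 - e^2] is the coefficient in [stable_defect_comparison], and [y0] is chosen so that
   [(e / y)^alpha <= s0] once [y >= y0]. *)
pose e := Num.sqrt D; have e0 : 0 < e by rewrite sqrtr_gt0.
pose y0 := e / s0 `^ (alpha^-1).
have y00 : 0 < y0 by rewrite divr_gt0// powR_gt0.
exists (c * e `^ alpha / 8), y0; split => //.
  by rewrite divr_gt0// mulr_gt0// powR_gt0.
move=> y y0y; have yp : 0 < y by exact: lt_le_trans y0y.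
pose l := e / y; have l0 : 0 < l by rewrite divr_gt0.
pose s := l `^ alpha.
have sE : s = e `^ alpha * y `^ (- alpha).
  by rewrite /s /l powRM ?invr_ge0 ?(ltW e0) ?(ltW yp)// powRV// ltW.
have ss0 : 0 <= s <= s0.
  rewrite powR_ge0/=.
  have -> : s0 = (s0 `^ alpha^-1) `^ alpha.
    by rewrite -powRrM mulVf ?gt_eqF// powRr1// ltW.
  apply: ge0_ler_powR; rewrite ?nnegrE ?powR_ge0 ?(ltW l0) ?(ltW alpha0)//.
  rewrite /l ler_pdivrMr//; move: y0y; rewrite /y0 ler_pdivrMr ?powR_gt0//; lra.
have := hc s ss0.
have -> : 1 - expR (- (s * a)) * cos (s * b) = 1 - \int[P]_w cos (l * Y w) by rewrite hY.
have -> : 1 - expR (- (k * s * a)) * cos (k * s * b) = 1 - \int[P]_w cos (2 * l * Y w).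
  have l20 : 0 < 2 * l by rewrite pmulr_rgt0.
  by rewrite hY// (powRM _ (ler0n _ 2) (ltW l0)).
rewrite -!mean_one_sub_cos -/D => h1.
pose A := [set w | y <= `|Y w|].
have mA : measurable A by exact: measurable_norm_ge.
(* With [C = cos (l Y)] this is [(1 - C) ((1 - C) - D / 2)]: at most 4 everywhere, and at most 0
   where [|Y| < y], since there [1 - C <= (l Y)^2 / 2 <= D / 2]. *)
pose h w := (2 - D / 2) * (1 - cos (l * Y w)) + - (1 / 2) * (1 - cos (2 * l * Y w)).
have i1 u : P.-integrable setT (EFin \o (fun w => 1 - cos (u * Y w))).
  apply: (@integrable_bounded_mean _ _ _ _ _ 2); first exact: measurable_one_sub_cosZ.
  by move=> w; rewrite ger0_norm ?one_sub_cos_ge0 ?one_sub_cos_le2.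
have i2 u v : P.-integrable setT (EFin \o (fun w => v * (1 - cos (u * Y w)))).
  by have := integrableZl _ v (i1 u); apply.
have hI : \int[P]_w h w = (2 - D / 2) * \int[P]_w (1 - cos (l * Y w))
    + - (1 / 2) * \int[P]_w (1 - cos (2 * l * Y w)).
  by rewrite /h RintegralD// !RintegralZl.
have hA : \int[P]_w h w <= \int[P]_w (4 * \1_A w).
  apply: le_Rintegral => //.
  - by have := integrableD _ (i2 l (2 - D / 2)) (i2 (2 * l) (- (1 / 2))); apply.
  - apply: (@integrable_bounded_mean _ _ _ _ _ 4).
      by apply: measurable_funM => //; exact: measurable_indic.
    by move=> w; rewrite indicE ger0_norm; case: (_ \in _); rewrite /= ?mulr1 ?mulr0.
  - move=> w _; rewrite /h.
    have -> : 1 - cos (2 * l * Y w) = 2 - 2 * cos (l * Y w) ^+ 2.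
      have -> : 2 * l * Y w = (l * Y w) *+ 2 by rewrite mulr2n; ring.
      by rewrite cos_mulr2n mulr2n; ring.
    have := one_sub_cos_le_sqr (l * Y w).
    have := cos_le1 (l * Y w); have := cos_geN1 (l * Y w).
    move: (cos _) => C C1 C2 hC.
    have -> : (2 - D / 2) * (1 - C) + - (1 / 2) * (2 - 2 * C ^+ 2) =
        (1 - C) * ((1 - C) - D / 2) by field.
    rewrite indicE; have [/set_mem/= yw|/negP nA] := boolP (w \in A).
      by rewrite mulr1; nra.
    rewrite mulr0; have {}nA : `|Y w| < y.
      by rewrite ltNge; apply/negP => ?; apply: nA; exact/mem_set.
    have : (l * Y w) ^+ 2 <= D.
      rewrite -[leRHS]sqr_sqrtr ?(ltW D0)// -/e -real_normK ?num_real//.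
      rewrite ler_sqr ?nnegrE ?(ltW e0)// normrM (gtr0_norm l0) /l mulrAC ler_pdivrMr//.
      by rewrite ler_pM2l// ltW.
    by nra.
have hP : \int[P]_w (4 * \1_A w) = 4 * fine (P A).
  rewrite RintegralZl//; last first.
    apply: (@integrable_bounded_mean _ _ _ _ _ 1); first exact: measurable_indic.
    by move=> w; rewrite indicE ger0_norm; case: (_ \in _).
  by congr (_ * _); rewrite /Rintegral integral_indic// setIT.
rewrite sE in h1; lra.
Qed.
End tails.

Lemma cos_eq1 (R : realType) (u : R) : `|u| < pi -> cos u = 1 -> u = 0.
Proof.
move=> up cu; apply/eqP; rewrite -normr_le0 leNgt; apply/negP => u0.
have : cos `|u| < cos (0 : R).
  by rewrite ltr_cos// in_itv/= ?normr_ge0 ?lexx ?(ltW up) ?pi_ge0.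
by rewrite cos_norm cu cos0 ltxx.
Qed.

(* If all the phases [2^-j y + t b 2^(-j alpha)] are multiples of [2 pi], then
   they vanish for large [j], since they tend to [0]. *)
Lemma vanishing_phases (R : realType) (alpha b t y : R) : 0 < alpha ->
  (forall j : nat, cos ((2^-1) ^+ j * y + t * ((2^-1) ^+ j) `^ alpha * b) = 1) ->
  \forall j \near \oo, y = - (t * b) * (((2^-1) ^+ j) `^ alpha * 2 ^+ j).
Proof.
move=> alpha0 hc.
have c1 : (2^-1) ^+ j * y @[j --> \oo] --> (0 : R).
  rewrite -[X in _ --> X](mul0r y); apply: cvgM; last exact: cvg_cst.
  by apply: cvg_expr; rewrite ger0_norm; lra.
have c2 : t * ((2^-1) ^+ j) `^ alpha * b @[j --> \oo] --> (0 : R).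
  rewrite -[X in _ --> X](mul0r b); apply: cvgM; last exact: cvg_cst.
  rewrite -[X in _ --> X](mulr0 t); apply: cvgM; first exact: cvg_cst.
  rewrite (_ : (fun j => _) = (fun j => (2^-1 `^ alpha) ^+ j)); last first.
    by apply/funext => j; rewrite powRX.
  by apply: cvg_expr; rewrite ger0_norm ?powR_ge0// powR_half_lt1.
have c12 : (2^-1) ^+ j * y + t * ((2^-1) ^+ j) `^ alpha * b @[j --> \oo] --> (0 : R).
  by rewrite -[X in _ --> X](addr0 (0 : R)); apply: cvgD.
have : \forall j \near \oo,
    `|(2^-1) ^+ j * y + t * ((2^-1) ^+ j) `^ alpha * b| < pi.
  by move/cvgr0Pnorm_lt : c12 => /(_ pi (pi_gt0 R)).
apply: filterS => j /cos_eq1/(_ (hc j)) h.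
have p2 : (2 : R) ^+ j != 0 by rewrite expf_neq0.
have : 2 ^+ j * ((2^-1) ^+ j * y + t * ((2^-1) ^+ j) `^ alpha * b) = 0 by rewrite h mulr0.
rewrite mulrDr mulrA -exprMn divff// expr1n mul1r; lra.
Qed.

(** * Positivity of the scale parameter *)

Section nondegenerate.
Context d (Omega : measurableType d) (R : realType) (P : probability Omega R).
Context (F : R -> set (set Omega)) (hF : usual_filtration P F).
Context (Z : R -> Omega -> R) (hZ : levy_process P F Z).

Lemma levy_measurable (t : R) : 0 <= t -> measurable_fun setT (Z t).
Proof.
move=> t0; have [hF1 _ _ _] := hF; have [hZ1 _ _ _] := hZ.
by move=> _ B mB; rewrite setTI; apply: (hF1 t t0).2; exact: hZ1.
Qed.

Context (alpha a b : R).
Hypothesis alpha_gt0 : 0 < alpha.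
Hypothesis hst : stable_marginals P alpha a b Z.

(** At a positive time with [cos (t * b) = 1], such as 2 pi / |b|, the mean of cos(Z(t)) is exp(- t
    a), which cannot exceed 1. *)
Lemma stable_scale_ge0 : 0 <= a.
Proof.
have key t : 0 <= t -> cos (t * b) = 1 -> 0 < t -> 0 <= a.
  move=> t0 ct tp; have [h _] := hst t0 ltr01.
  have : \int[P]_w cos (1 * Z t w) <= 1.
    have := mean_one_sub_cos P (levy_measurable t0) 1.
    have : 0 <= \int[P]_w (1 - cos (1 * Z t w)).
      by apply: Rintegral_ge0 => w _; exact: one_sub_cos_ge0.
    lra.
  rewrite h powR1 !mulr1 ct mulr1 -[leRHS]expR0 ler_expR oppr_le0.
  by rewrite pmulr_rge0.
have [b0|b0] := eqVneq b 0; first by apply: (key 1) => //; rewrite b0 mulr0 cos0.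
have nb0 : 0 < `|b| by rewrite normr_gt0.
have t0 : 0 < pi *+ 2 / `|b| by rewrite divr_gt0// pmulrn_lgt0// pi_gt0.
apply: (key (pi *+ 2 / `|b|)) => //; first exact: ltW.
by rewrite -cos_norm normrM (gtr0_norm t0) mulfVK ?gt_eqF// cos2pi.
Qed.

(** When [a = 0] the addition formula gives the shifted cosine the mean cos^2 c + sin^2 c = 1, so
    the nonnegative variable 1 - cos has mean 0. *)
Lemma null_scale_phase (t l : R) : a = 0 -> 0 <= t -> 0 < l ->
  \forall w \ae P, cos (l * Z t w + t * l `^ alpha * b) = 1.
Proof.
move=> a0 t0 l0; have [hc hs] := hst t0 l0.
rewrite a0 mulr0 oppr0 expR0 !mul1r in hc hs.
set c := t * l `^ alpha * b in hc hs *.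
have mZ := levy_measurable t0.
have mcos : measurable_fun setT (fun w => cos (l * Z t w + c)).
  apply: (measurableT_comp (f := cos)).
    by apply: continuous_measurable_fun; exact: continuous_cos.
  by apply: measurable_funD => //; exact: measurable_funM.
have msin : measurable_fun setT (fun w => sin (l * Z t w)).
  apply: (measurableT_comp (f := sin)).
    by apply: continuous_measurable_fun; exact: continuous_sin.
  exact: measurable_funM.
have mg : measurable_fun setT (fun w => 1 - cos (l * Z t w + c)) by exact: measurable_funB.
have isn : P.-integrable setT (EFin \o (fun w => sin (l * Z t w))).
  by apply: (@integrable_bounded_mean _ _ _ _ _ 1) => // w; exact: sin_max.
have ic := integrable_cosZ P mZ l.
have E : \int[P]_w (1 - cos (l * Z t w + c)) = 0.
  rewrite RintegralB//; last 2 first.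
  - exact: (finite_measure_integrable_cst _ 1).
  - by apply: (@integrable_bounded_mean _ _ _ _ _ 1) => // w; exact: cos_max.
  rewrite [X in X - _](mean_cst P 1).
  under eq_Rintegral do rewrite cosD [cos (l * _) * _]mulrC [sin (l * _) * _]mulrC.
  rewrite RintegralB//; last 2 first.
  - by have := integrableZl _ (cos c) ic; apply.
  - by have := integrableZl _ (sin c) isn; apply.
  rewrite !RintegralZl// hc hs mulrN opprK -!expr2 cos2Dsin2 subrr//.
have : (\int[P]_w `|(1 - cos (l * Z t w + c))%:E| = 0)%E.
  under eq_integral do rewrite gee0_abs ?lee_fin ?one_sub_cos_ge0//.
  rewrite -[LHS]fineK; first by rewrite -/(Rintegral _ _ _) E.
  apply: integrable_fin_num => //.
  apply: (@integrable_bounded_mean _ _ _ _ _ 2) => // w.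
  by rewrite ger0_norm ?one_sub_cos_ge0 ?one_sub_cos_le2.
have mg' : measurable_fun setT (fun w => (1 - cos (l * Z t w + c))%:E).
  exact/measurable_EFinP.
move/(ae_eq_integral_abs P measurableT mg'); apply: filterS => w /(_ I) [].
by move=> /eqP; rewrite subr_eq0 => /eqP.
Qed.

Lemma stable_scale_gt0 : ~ pure_drift P Z -> 0 < a.
Proof.
move=> nd; rewrite lt_def stable_scale_ge0 andbT; apply/eqP => a0; apply: nd.
have hae t : 0 <= t -> \forall w \ae P, \forall j \near \oo,
    Z t w = - (t * b) * (((2^-1) ^+ j) `^ alpha * 2 ^+ j).
  move=> t0; have : \forall w \ae P, forall j : nat,
      cos ((2^-1) ^+ j * Z t w + t * ((2^-1) ^+ j) `^ alpha * b) = 1.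
    apply/ae_foralln => j; apply: null_scale_phase => //; exact: exprn_gt0.
  by apply: filterS => w; exact: vanishing_phases.
(* The slope is read off at time 1 from a single sample point. For large [j] the formula is [t]
   times a factor free of [t] and [w], so this slope serves for all of them. *)
have [w1 h1] : exists w, \forall j \near \oo,
    Z 1 w = - (1 * b) * (((2^-1) ^+ j) `^ alpha * 2 ^+ j).
  have [A [mA PA hA]] := hae 1 ler01.
  apply: contrapT => nw; have AT : A = setT.
    by apply/seteqP; split => // w _; apply: hA => h; apply: nw; exists w.
  by move: PA; rewrite AT [LHS]probability_setT => /eqP; rewrite onee_eq0.
exists (Z 1 w1).
have hct t : 0 <= t -> \forall w \ae P, Z t w = Z 1 w1 * t.
  move=> t0; have := hae t t0; apply: filterS => w hw.
  have [j [-> ->]] : exists j : nat, Z t w = - (t * b) * (((2^-1) ^+ j) `^ alpha * 2 ^+ j)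
    /\ Z 1 w1 = - (1 * b) * (((2^-1) ^+ j) `^ alpha * 2 ^+ j).
    apply: (@filter_ex _ \oo); near=> j; split; near: j => //.
  by ring.
have [_ hcad _ _] := hZ.
(* Countably many rational times share one null set; right-continuity then reaches every [t] from
   the grid point [q] just after it. *)
have hr : \forall w \ae P, forall n k : nat, Z (k%:R / n.+1%:R) w = Z 1 w1 * (k%:R / n.+1%:R).
  by apply/ae_foralln => n; apply/ae_foralln => k; apply: hct; rewrite divr_ge0.
apply: filterS2 hcad hr => w [_ cad] hw t t0.
apply/eqP; rewrite -subr_eq0 -normr_le0; apply/ler_addgt0Pr => e e0; rewrite add0r.
have e2 : 0 < e / 2 by rewrite divr_gt0.
have [dd dd0 hd] := cadlag_right cad t0 e2.
pose c := Z 1 w1; pose dl := Num.min dd (e / 2 / (`|c| + 1)).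
have dl0 : 0 < dl by rewrite lt_min dd0/= divr_gt0// ltr_wpDl.
pose n := Num.truncn dl^-1.
have ndl : n.+1%:R^-1 < dl by rewrite invf_plt ?posrE// truncnS_gt.
pose k := (Num.truncn (t * n.+1%:R)).+1.
have /truncn_itv/andP[k1 k2] : 0 <= t * n.+1%:R by rewrite mulr_ge0.
pose q : R := k%:R / n.+1%:R.
have tq : t <= q by rewrite /q ler_pdivlMr// ltW.
have qt : q <= t + n.+1%:R^-1.
  by rewrite /q ler_pdivrMr// mulrDl mulVf// /k -natr1 lerD2r.
have h3 : `|Z q w - Z t w| < e / 2.
  by apply: hd; rewrite tq (le_lt_trans qt)// ltrD2l (lt_le_trans ndl)// /dl ge_min lexx.
have h4 : `|c * (q - t)| <= e / 2.
  rewrite normrM (ger0_norm (x := q - t)) ?subr_ge0//.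
  have h5 : q - t <= e / 2 / (`|c| + 1).
    rewrite lerBlDl (le_trans qt)// lerD2l (le_trans (ltW ndl))//.
    by rewrite /dl ge_min lexx orbT.
  have c1 : 0 < `|c| + 1 by rewrite ltr_wpDl.
  rewrite ler_pdivlMr// in h5.
  have : `|c| * (q - t) <= (q - t) * (`|c| + 1) by rewrite mulrC ler_wpM2l ?subr_ge0// lerDl.
  lra.
have E : Z t w - Z 1 w1 * t = - (Z q w - Z t w) + c * (q - t).
  by rewrite /q hw -/q -/c; ring.
rewrite E (le_trans (ler_normD _ _))// normrN; lra.
Unshelve. all: by end_near. Qed.
End nondegenerate.

(** * Fluctuations of the stable process *)

Lemma measurable_wrt_sub (Omega : pointedType) (R : realType) (G : set (set Omega))
    (Y1 Y2 : Omega -> R) : sigma_algebra setT G ->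
  measurable_wrt G Y1 -> measurable_wrt G Y2 -> measurable_wrt G (Y1 \- Y2).
Proof.
move=> sG h1 h2 B mB.
have eG : <<s G >> = G by exact: sigma_algebra_id.
have m1 : measurable_fun (setT : set (g_sigma_algebraType G)) Y1.
  by move=> _ C mC; rewrite setTI /measurable/= eG; exact: h1.
have m2 : measurable_fun (setT : set (g_sigma_algebraType G)) Y2.
  by move=> _ C mC; rewrite setTI /measurable/= eG; exact: h2.
have := measurable_funB m1 m2 measurableT mB.
by rewrite setTI {1}/measurable/= eG.
Qed.

Section levy_increments.
Context d (Omega : measurableType d) (R : realType) (P : probability Omega R).
Context (F : R -> set (set Omega)) (hF : usual_filtration P F).
Context (Z : R -> Omega -> R) (hZ : levy_process P F Z).
Context (alpha a b : R).
Hypothesis alpha_gt0 : 0 < alpha.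
Hypothesis hst : stable_marginals P alpha a b Z.

Lemma filtration_measurable (t : R) A : 0 <= t -> F t A -> measurable A.
Proof. by move=> t0; have [h _ _ _] := hF; have [_] := h t t0; apply. Qed.

Lemma increment_wrt (s t : R) : 0 <= s -> s <= t -> measurable_wrt (F t) (increment Z s t).
Proof.
move=> s0 st; have t0 := le_trans s0 st.
have [h1 h2 _ _] := hF; have [ad _ _ _] := hZ.
apply: (@measurable_wrt_sub Omega R (F t) (Z t) (Z s)); first exact: (h1 t t0).1.
  exact: ad.
by move=> B mB; apply: (h2 s t s0 st); exact: ad.
Qed.

(** [Z 0 = 0] holds only almost surely, so [increment Z 0 (t - s)] and [Z (t - s)] are compared off
    a null set. *)
Lemma increment_law (s t : R) (B : set (measurableTypeR R)) : 0 <= s -> s <= t -> measurable B ->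
  P (increment Z s t @^-1` B) = P (Z (t - s) @^-1` B).
Proof.
move=> s0 st mB; have [_ h0 _ ->//] := hZ.
have ts0 : 0 <= t - s by rewrite subr_ge0.
have m1 : measurable (increment Z 0 (t - s) @^-1` B).
  by apply: (filtration_measurable ts0); exact: increment_wrt.
have m2 : measurable (Z (t - s) @^-1` B).
  by have := levy_measurable hF hZ ts0 measurableT mB; rewrite setTI.
have [N [mN PN hN]] := h0.
have le1 (A C : set Omega) : measurable A -> measurable C -> A `<=` C `|` N -> (P A <= P C)%E.
  move=> mA mC AC; apply: (@le_trans _ _ (P (C `|` N))).
    by apply: le_measure; rewrite ?inE//; exact: measurableU.
  by apply: le_trans (measureU2 _ mC mN) _; rewrite [X in (_ + X)%E]PN adde0.
have hw w : ~ N w -> increment Z 0 (t - s) w = Z (t - s) w.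
  move=> nN; have [z0 _] : Z 0 w = 0 /\ cadlag (Z ^~ w).
    by apply: contrapT => h; apply: nN; exact: hN.
  by rewrite /increment z0 subr0.
apply/eqP; rewrite eq_le; apply/andP; split; apply: le1 => // w /=.
  by have [?|/hw ->] := pselect (N w); [right|left].
by have [?|/hw <-] := pselect (N w); [right|left].
Qed.

Definition norm_ge (x : R) : set (measurableTypeR R) := [set y | x <= `|y|].

Lemma measurable_norm_ge_set (x : R) : measurable (norm_ge x).
Proof. exact: (@measurable_norm_ge _ (measurableTypeR R) R id (@measurable_id _ _ _) x). Qed.

Lemma stable_tail (t x : R) : 0 <= t -> 0 < x ->
  fine (P (Z t @^-1` norm_ge x)) <= tail_constant alpha * (a + `|b|) * t * x `^ (- alpha).
Proof.
move=> t0 x0; have a0 := stable_scale_ge0 hF hZ hst.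
rewrite -[X in X * x `^ _]mulrA.
apply: (@tail_upper _ _ _ P (Z t) (levy_measurable hF hZ t0)) => //.
  by rewrite mulr_ge0// addr_ge0.
move=> l l0; have [-> _] := hst t0 l0.
rewrite -[leRHS]mulrA; apply: stable_defect_le => //.
by rewrite mulr_ge0// powR_ge0.
Qed.

Lemma increment_tail (s t x : R) : 0 <= s -> s <= t -> 0 < x ->
  fine (P (increment Z s t @^-1` norm_ge x))
    <= tail_constant alpha * (a + `|b|) * (t - s) * x `^ (- alpha).
Proof.
move=> s0 st x0; rewrite increment_law//; last exact: measurable_norm_ge_set.
by apply: stable_tail; rewrite ?subr_ge0.
Qed.

(* First-passage decomposition: once [|Z (tau k)| > 2 x], the independent
   increment up to [T] is smaller than [x] with probability at least 1/2. *)
Lemma ottaviani (T x : R) (tau : nat -> R) :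
  (forall k, 0 <= tau k) -> {homo tau : k l / (k <= l)%N >-> k <= l} ->
  (forall k, tau k <= T) ->
  (forall k, fine (P (increment Z (tau k) T @^-1` norm_ge x)) <= 2^-1) ->
  forall n, fine (P (\bigcup_(k in `I_n) (Z (tau k) @^-1` norm_ge (2 * x))))
    <= 2 * fine (P (Z T @^-1` norm_ge x)).
Proof.
move=> tau0 tau_nd tauT hx n.
have T0 : 0 <= T := le_trans (tau0 0%N) (tauT 0%N).
pose D k := \bigcup_(j in `I_k) (Z (tau j) @^-1` norm_ge (2 * x)).
pose E := Z T @^-1` norm_ge x.
have [ad _ hind _] := hZ; have [hF1 hF2 _ _] := hF.
have mE : measurable E.
  by apply: (filtration_measurable T0); apply: ad => //; exact: measurable_norm_ge_set.
have FZ k : F (tau k) (Z (tau k) @^-1` norm_ge (2 * x)).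
  by apply: ad => //; exact: measurable_norm_ge_set.
(* [D k] involves only [tau j] with [j < k], hence the bound [l.+1]. *)
have FD k l : (k <= l.+1)%N -> F (tau l) (D k).
  move=> kl; have [_ _ hU] := (hF1 (tau l) (tau0 l)).1.
  rewrite /D bigcup_mkcond; apply: hU => j; case: ifPn => [|_].
    rewrite inE /= => jk; apply: (hF2 (tau j)) => //.
    by apply: tau_nd; rewrite -ltnS (leq_trans jk).
  by have [] := (hF1 (tau l) (tau0 l)).1.
have mD k : measurable (D k).
  by apply: (filtration_measurable (tau0 k)); apply: FD; exact: leqnSn.
have fE (A : set Omega) : measurable A -> P A \is a fin_num by move=> mA; exact: fin_num_measure.
(* Keeping the intersection with [E] on the right makes both sides additive over the disjoint
   first-passage events [A], so induction applies. *)
suff key k : fine (P (D k)) <= 2 * fine (P (D k `&` E)).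
  rewrite (le_trans (key n))// ler_wpM2l// fine_le ?fE//; first exact: measurableI.
  by apply: le_measure; rewrite ?inE//; exact: measurableI.
elim: k => [|k IH].
  rewrite (_ : D 0%N = set0); first by rewrite set0I measure0 mulr0.
  by rewrite /D II0 bigcup_set0.
pose A := Z (tau k) @^-1` norm_ge (2 * x) `\` D k.
have DS : D k.+1 = D k `|` A.
  rewrite /A setUDr setDv setD0 /D IIS bigcup_setU bigcup_set1 //.
have AD : D k `&` A = set0 by rewrite /A setDE setIC -setIA setICl setI0.
have FA : F (tau k) A.
  have [s0 sD _] := (hF1 (tau k) (tau0 k)).1.
  have [_ _ _ hI] := (sigma_algebraP (fun X _ => @subsetT _ X)).1 (hF1 (tau k) (tau0 k)).1.
  rewrite /A setDE; apply: hI; first exact: FZ.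
  by rewrite -setTD; apply: sD; apply: FD; exact: leqnSn.
have mA : measurable A by exact: (filtration_measurable (tau0 k)).
have mDE : measurable (D k `&` E) by exact: measurableI.
have mAE : measurable (A `&` E) by exact: measurableI.
pose G := increment Z (tau k) T @^-1` (~` norm_ge x).
have mG : measurable G.
  apply: (filtration_measurable T0); apply: increment_wrt => //.
  by apply: measurableC; exact: measurable_norm_ge_set.
have PG : 2^-1 <= fine (P G).
  have mH : measurable (increment Z (tau k) T @^-1` norm_ge x).
    by apply: (filtration_measurable T0); apply: increment_wrt => //; exact: measurable_norm_ge_set.
  have -> : G = ~` (increment Z (tau k) T @^-1` norm_ge x) by [].
  by rewrite probability_setC// fineB// ?fE//; have := hx k; rewrite /=; lra.
have PAG : fine (P (A `&` G)) = fine (P A) * fine (P G).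
  rewrite -fineM ?fE//; congr fine; apply: hind => //.
  by apply: measurableC; exact: measurable_norm_ge_set.
have sub : A `&` G `<=` A `&` E.
  move=> w [[h1 h2]]; rewrite /G /E /norm_ge /increment/= => /negP; rewrite -ltNge => h3.
  split => //=; rewrite /preimage/= in h1.
  have := ler_normB (Z T w) (Z T w - Z (tau k) w).
  rewrite opprB addrC subrK => h4; rewrite /norm_ge/= in h1; lra.
have le2 : fine (P (A `&` G)) <= fine (P (A `&` E)).
  rewrite fine_le ?fE//; first exact: measurableI.
  by apply: le_measure; rewrite ?inE//; exact: measurableI.
have e1 : fine (P (D k `|` A)) = fine (P (D k)) + fine (P A).
  by rewrite -fineD ?fE//; congr fine; exact: measureU.
have e2 : fine (P ((D k `|` A) `&` E)) = fine (P (D k `&` E)) + fine (P (A `&` E)).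
  rewrite -fineD ?fE// setIUl; congr fine; apply: measureU => //.
  by rewrite setIACA AD set0I.
have PA0 : 0 <= fine (P A) by rewrite fine_ge0.
have : fine (P A) * 2^-1 <= fine (P A) * fine (P G) by rewrite ler_wpM2l.
rewrite DS e1 e2; lra.
Qed.
End levy_increments.

(** * Maximal inequality in continuous time *)

Section maximal_inequality.
Context d (Omega : measurableType d) (R : realType) (P : probability Omega R).
Context (F : R -> set (set Omega)) (hF : usual_filtration P F).
Context (Z : R -> Omega -> R) (hZ : levy_process P F Z).
Context (alpha a b : R).
Hypothesis alpha_gt0 : 0 < alpha.
Hypothesis hst : stable_marginals P alpha a b Z.

(** The cap at [T] gives times in [[0, T]] for every index [k], as [ottaviani] requires. *)
Let grid (T : R) (n k : nat) : R := Num.min (k%:R * T / 2 ^+ n) T.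

Let dyadic_exceed (T y : R) (n : nat) : set Omega :=
  \bigcup_(k in `I_(2 ^ n).+1) (Z (grid T n k) @^-1` norm_ge y).

(** A countable, hence measurable, substitute for the event that the running supremum of [|Z|]
    reaches [y]; [exceedance_path] links it to cadlag paths. *)
Definition exceedance (T y : R) : set Omega := \bigcup_n dyadic_exceed T y n.

Let grid_ge0 (T : R) n k : 0 <= T -> 0 <= grid T n k.
Proof. by move=> T0; rewrite le_min T0 andbT divr_ge0 ?mulr_ge0 ?exprn_ge0. Qed.

Let measurable_dyadic_exceed (T y : R) n : 0 <= T -> measurable (dyadic_exceed T y n).
Proof.
move=> T0; apply: bigcup_measurable => k _.
have := levy_measurable hF hZ (grid_ge0 n k T0) measurableT (measurable_norm_ge_set y).
by rewrite setTI.
Qed.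

Lemma measurable_exceedance (T y : R) : 0 <= T -> measurable (exceedance T y).
Proof. by move=> T0; apply: bigcupT_measurable => n; exact: measurable_dyadic_exceed. Qed.

Let dyadic_exceed_nd (T y : R) : nondecreasing_seq (dyadic_exceed T y).
Proof.
apply/nondecreasing_seqP => n; apply/subsetPset => w [k /= kn hk].
exists (2 * k)%N; first by rewrite /= expnS ltnS leq_pmul2l// -ltnS.
suff -> : grid T n.+1 (2 * k) = grid T n k by [].
rewrite /grid natrM exprS invfM; congr Num.min.
by field; rewrite expf_neq0.
Qed.

(** If the tail bound at [T] exceeds 1/2, the right-hand side exceeds 1. Otherwise it verifies the
    hypothesis of [ottaviani] on each dyadic grid, and continuity of measure passes to the union. *)
Lemma maximal_inequality (T x : R) : 0 <= T -> 0 < x ->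
  (P (exceedance T (2 * x)) <=
    (2 * (tail_constant alpha * (a + `|b|) * T * x `^ (- alpha)))%:E)%E.
Proof.
move=> T0 x0; set K := tail_constant alpha * (a + `|b|).
have K0 : 0 <= K.
  apply: mulr_ge0; first by apply: ltW; exact: tail_constant_gt0.
  by apply: addr_ge0 => //; exact: (stable_scale_ge0 hF hZ hst).
have px0 : 0 <= x `^ (- alpha) by exact: powR_ge0.
have [small|large] := leP (K * T * x `^ (- alpha)) 2^-1; last first.
  apply: le_trans (probability_le1 P (measurable_exceedance _ T0)) _.
  by rewrite lee_fin; lra.
have cv : P (dyadic_exceed T (2 * x) n) @[n --> \oo] --> P (exceedance T (2 * x)).
  apply: nondecreasing_cvg_mu => //.
  - by move=> n; exact: measurable_dyadic_exceed.
  - exact: measurable_exceedance.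
rewrite -(cvg_lim _ cv)//; apply: lime_le; first by apply/cvg_ex; eexists; exact: cv.
apply: nearW => n; rewrite -fine_probE ?lee_fin; last exact: measurable_dyadic_exceed.
apply: (le_trans (@ottaviani _ _ _ _ _ hF _ hZ T x (grid T n) _ _ _ _ (2 ^ n).+1)).
- by move=> k; exact: grid_ge0.
- move=> k l kl; rewrite le_min [X in _ && X]ge_min lexx orbT andbT ge_min; apply/orP; left.
  by rewrite ler_pM2r ?invr_gt0 ?exprn_gt0// ler_wpM2r// ler_nat.
- by move=> k; rewrite ge_min lexx orbT.
- move=> k; have g0 := grid_ge0 n k T0.
  have gT : grid T n k <= T by rewrite ge_min lexx orbT.
  apply: le_trans (increment_tail hF hZ alpha_gt0 hst g0 gT x0) _.
  apply: le_trans small; rewrite ler_wpM2r// ler_wpM2l//; lra.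
- rewrite ler_wpM2l//; exact: (stable_tail hF hZ alpha_gt0 hst).
Qed.

Lemma exceedance_path (T y : R) (w : Omega) : cadlag (Z ^~ w) -> ~ exceedance T y w ->
  forall t, 0 <= t < T -> `|Z t w| <= y.
Proof.
move=> cad nex t /andP[t0 tT]; rewrite leNgt; apply/negP => yZ; apply: nex.
have T0 : 0 < T := le_lt_trans t0 tT.
have e0 : 0 < `|Z t w| - y by rewrite subr_gt0.
have [dd dd0 hd] := cadlag_right cad t0 e0.
pose dl := Num.min dd (T - t).
have dl0 : 0 < dl by rewrite lt_min dd0 subr_gt0.
have [n _ /(_ n (leqnn _)) nn] := near_infty_natSinv_expn_lt (PosNum (divr_gt0 dl0 T0)).
have p2 : (0 : R) < 2 ^+ n by rewrite exprn_gt0.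
have hn : T / 2 ^+ n < dl by move: nn; rewrite /= ltr_pdivlMr// div1r mulrC.
pose u := t / T * 2 ^+ n.
(* The first grid index strictly beyond [t]: the exceedance at [t] persists there by
   right-continuity. *)
pose k := (Num.truncn u).+1.
have u0 : 0 <= u by rewrite mulr_ge0 ?divr_ge0// ltW.
have /truncn_itv/andP[k1 k2] := u0.
have tE : t = u * T / 2 ^+ n by rewrite /u; field; rewrite !gt_eqF.
have c0 : 0 < T / 2 ^+ n by rewrite divr_gt0.
pose q := k%:R * T / 2 ^+ n.
have eA v : v * T / 2 ^+ n = v * (T / 2 ^+ n) by rewrite mulrA.
have tq : t <= q by rewrite {1}tE /q !eA ler_pM2r// ltW.
have qt : q <= t + T / 2 ^+ n.
  rewrite [X in _ <= X + _]tE /q !eA /k -natr1 mulrDl mul1r lerD2r ler_pM2r//.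
have qdl : q < t + dl by rewrite (le_lt_trans qt)// ltrD2l.
have dldd : dl <= dd by rewrite ge_min lexx.
have dlT : dl <= T - t by rewrite ge_min lexx orbT.
have qT : q <= T by lra.
have gq : grid T n k = q by rewrite /grid -/q; apply/min_idPl.
exists n => //; exists k => /=.
  rewrite ltnS -(ler_nat R) natrX.
  by move: qT; rewrite /q ler_pdivrMr// [T * _]mulrC ler_pM2r.
rewrite /preimage gq /norm_ge/=.
have : `|Z q w - Z t w| < `|Z t w| - y by apply: hd; rewrite tq; lra.
have := ler_normB (Z q w) (Z q w - Z t w).
by rewrite opprB addrC subrK; lra.
Qed.
End maximal_inequality.

(** * Comparison of the integral with dyadic and unit series *)

Section gamma_series.
Context (R : realType) (alpha : R) (gamma : R -> R).
Hypothesis alpha_gt0 : 0 < alpha.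
Hypothesis gamma_cont : {within `]0, +oo[, continuous gamma}.
Hypothesis gamma_gt0 : forall t : R, 0 < t -> 0 < gamma t.
Hypothesis gamma_nd : forall s t : R, 0 < s -> s <= t -> gamma s <= gamma t.

Let h (s : R) : \bar R := (gamma s `^ (- alpha))%:E.

Let measurable_h (c : R) (b : itv_bound R) : 0 <= c -> measurable_fun [set` Interval (BRight c) b] h.
Proof.
move=> c0; apply/measurable_EFinP.
apply: (@measurable_funS _ _ _ _ `](0 : R), +oo[%classic) => //.
  move=> s /=; rewrite !in_itv/= => /andP[cs _]; rewrite andbT (le_lt_trans c0)//.
apply: (measurableT_comp (f := (@powR R ^~ (- alpha)))); first exact: measurable_powR.
exact: subspace_continuous_measurable_fun.
Qed.

Let h_ge0 s : (0 <= h s)%E. Proof. by rewrite lee_fin powR_ge0. Qed.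

Let integral_h_itv (c e : R) : 0 < c -> c <= e ->
  ((gamma e `^ (- alpha) * (e - c))%:E <= \int[lebesgue_measure]_(s in `]c, e]) h s)%E /\
  (\int[lebesgue_measure]_(s in `]c, e]) h s <= (gamma c `^ (- alpha) * (e - c))%:E)%E.
Proof.
move=> c0 ce.
have cst (k : R) : (\int[lebesgue_measure]_(s in `]c, e]) k%:E = (k * (e - c))%:E)%E.
  rewrite integral_cst//= lebesgue_measure_itv/= lte_fin.
  by move: ce; rewrite le_eqVlt => /predU1P[<-|->]; rewrite ?ltxx ?subrr ?mule0 ?mulr0.
rewrite -!cst; split; apply: ge0_le_integral => //.
- by move=> s _; rewrite lee_fin powR_ge0.
- by apply: measurable_h; exact: ltW.
- move=> s /=; rewrite in_itv/= => /andP[cs se]; rewrite lee_fin.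
  have s0 := lt_trans c0 cs.
  by apply: ler_powRN; [exact: ltW|exact: gamma_gt0|exact: gamma_nd].
- by apply: measurable_h; exact: ltW.
- move=> s /=; rewrite in_itv/= => /andP[cs se]; rewrite lee_fin.
  by apply: ler_powRN; [exact: ltW|exact: gamma_gt0|apply: gamma_nd => //; exact: ltW].
Qed.

Let integral_series (u : nat -> R) : 0 < u 0%N -> {homo u : m n / (m <= n)%N >-> m <= n} ->
  (\int[lebesgue_measure]_(s in \bigcup_i `]u i, u i.+1]%classic) h s =
   \sum_(i <oo) \int[lebesgue_measure]_(s in `]u i, u i.+1]) h s)%E.
Proof.
move=> u0 und; apply: ge0_integral_bigcup => //.
- apply: (@measurable_funS _ _ _ _ `](0 : R), +oo[%classic) => //; last exact: measurable_h.
  move=> s [i _] /=; rewrite !in_itv/= => /andP[us _]; rewrite andbT.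
  by rewrite (lt_trans _ us)// (lt_le_trans u0)// und.
- apply/trivIsetP => i j _ _; wlog ij : i j / (i < j)%N.
    move=> H; rewrite neq_ltn => /orP[ij|ji]; first by apply: H => //; rewrite neq_ltn ij.
    by rewrite setIC; apply: H => //; rewrite neq_ltn ji.
  move=> _; rewrite -subset0 => s [] /=; rewrite !in_itv/= => /andP[_ si] /andP[sj _].
  by have := lt_le_trans sj si; rewrite ltNge und.
Qed.

(** By monotonicity each term is at most twice the integral over the dyadic block that ends at
    [2^(k0 + i)]; blocks end one power later than they start, hence [j.+2] against [j.+1]. *)
Lemma dyadic_series_lty (a : R) : 0 <= a ->
  (\int[lebesgue_measure]_(s in `]a, +oo[) h s < +oo)%E ->
  exists k0, (\sum_(i <oo) (2 ^+ (k0 + i) * gamma (2 ^+ (k0 + i)) `^ (- alpha))%:E < +oo)%E.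
Proof.
move=> a0 fin; pose j := Num.truncn a.
have aj : a <= 2 ^+ j.+1.
  rewrite (le_trans (ltW (truncnS_gt a)))// -natrX ler_nat.
  by rewrite ltnW// ltn_expl.
exists j.+2; pose u i : R := 2 ^+ (j.+1 + i).
have und : {homo u : m n / (m <= n)%N >-> m <= n}.
  by move=> m n mn; rewrite /u ler_weXn2l ?ler1n// leq_add2l.
have u0 : 0 < u 0%N by rewrite exprn_gt0.
apply: (@le_lt_trans _ _ (2%:E * \sum_(i <oo) \int[lebesgue_measure]_(s in `]u i, u i.+1]) h s)%E).
  rewrite -nneseriesZl; last by move=> i _; apply: integral_ge0.
  apply: lee_nneseries => [i _ _|i _]; first by rewrite lee_fin mulr_ge0 ?powR_ge0 ?exprn_ge0.
  have ui : 0 < u i by rewrite exprn_gt0.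
  have [h1 _] := integral_h_itv ui (und _ _ (leqnSn i)).
  apply: le_trans (lee_wpmul2l _ h1); last by rewrite lee_fin.
  rewrite -EFinM lee_fin /u addSn addnS ![2 ^+ _.+1]exprS.
  set v := 2 ^+ (j + i); set g := gamma _ `^ _; lra.
rewrite lte_mul_pinfty// -integral_series//.
apply: le_lt_trans fin; apply: ge0_subset_integral => //.
- exact: bigcupT_measurable.
- exact: measurable_h.
- move=> s [i _] /=; rewrite !in_itv/= => /andP[us _]; rewrite andbT.
  by rewrite (le_lt_trans aj)// (le_lt_trans _ us)// (le_trans _ (und _ _ (leq0n i)))// /u addn0.
Qed.

(** Bounded partial sums would bound the integral beyond 1, and []a, 1]] adds a finite amount
    because [gamma] is at least [gamma a > 0] there. *)
Lemma unit_series_unbounded (a : R) : 0 < a ->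
  (\int[lebesgue_measure]_(s in `]a, +oo[) h s = +oo)%E ->
  forall B : R, exists n, B <= \sum_(0 <= i < n) gamma i.+1%:R `^ (- alpha).
Proof.
move=> a0 inf B; apply: contrapT => nB.
have hB n : \sum_(0 <= i < n) gamma i.+1%:R `^ (- alpha) <= B.
  by rewrite leNgt; apply/negP => /ltW hn; apply: nB; exists n.
pose u i : R := i.+1%:R.
have und : {homo u : m n / (m <= n)%N >-> m <= n} by move=> m n mn; rewrite /u ler_nat.
have u0 : 0 < u 0%N by [].
have fin1 : (\int[lebesgue_measure]_(s in `]1%R, +oo[) h s <= B%:E)%E.
  apply: (@le_trans _ _ (\int[lebesgue_measure]_(s in \bigcup_i `]u i, u i.+1]%classic) h s)%E).
    apply: ge0_subset_integral => //; first by apply: bigcupT_measurable.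
      apply: (@measurable_funS _ _ _ _ `](0 : R), +oo[%classic) => //; last exact: measurable_h.
      move=> s [i _] /=; rewrite !in_itv/= => /andP[us _]; rewrite andbT.
      by rewrite (lt_trans _ us)// (lt_le_trans u0)// und.
    move=> s /=; rewrite in_itv/= andbT => s1.
    have : exists n : nat, s <= n%:R.
      by exists (Num.truncn s).+1; rewrite ltW// truncnS_gt.
    move=> /ex_minnP[[|[|n]] sn hmin]; [lra|by move: sn; rewrite leNgt s1|].
    exists n => //=; rewrite in_itv/= sn andbT ltNge; apply/negP => ns.
    by have := hmin _ ns; rewrite ltnn.
  rewrite integral_series//; apply: lime_le.
    by apply: is_cvg_nneseries => n _ _; apply: integral_ge0.
  apply: nearW => n; apply: (@le_trans _ _ (\sum_(0 <= i < n) gamma i.+1%:R `^ (- alpha))%:E).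
    2: by rewrite lee_fin.
  rewrite -sumEFin; apply: lee_sum => i _.
  have ui : 0 < u i by [].
  have [_] := integral_h_itv ui (und _ _ (leqnSn i)).
  by rewrite /u -[i.+2%:R]natr1 [_ + 1 - _]addrAC subrr add0r mulr1.
suff : (\int[lebesgue_measure]_(s in `]a, +oo[) h s < +oo)%E by rewrite inf ltxx.
have [a1|a1] := leP 1 a.
  apply: (le_lt_trans _ (le_lt_trans fin1 (ltry _))); apply: ge0_subset_integral => //.
    exact: measurable_h.
  by move=> s /=; rewrite !in_itv/= !andbT; exact: le_lt_trans.
have sE : `]a, +oo[%classic = `]a, 1]%classic `|` `]1, +oo[%classic :> set R.
  by rewrite -itv_bndbnd_setU// bnd_simp ltW.
rewrite sE ge0_integral_setU//; last 2 first.
- by rewrite -sE; apply: measurable_h; exact: ltW.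
- apply/disj_setPS => s [] /=; rewrite !in_itv/= => /andP[_ s1].
  by rewrite andbT ltNge s1.
apply: lte_add_pinfty; last exact: le_lt_trans fin1 (ltry _).
have [_ h2] := integral_h_itv a0 (ltW a1).
exact: le_lt_trans h2 (ltry _).
Qed.
End gamma_series.

(** * The two Borel-Cantelli arguments *)

Section growth_of_levy.
Context d (Omega : measurableType d) (R : realType) (P : probability Omega R).
Context (F : R -> set (set Omega)) (hF : usual_filtration P F).
Context (Z : R -> Omega -> R) (hZ : levy_process P F Z).
Context (alpha a b : R).
Hypothesis alpha_gt0 : 0 < alpha.
Hypothesis hst : stable_marginals P alpha a b Z.
Context (gamma : R -> R).
Hypothesis gamma_cont : {within `]0, +oo[, continuous gamma}.
Hypothesis gamma_gt0 : forall t : R, 0 < t -> 0 < gamma t.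
Hypothesis gamma_nd : forall s t : R, 0 < s -> s <= t -> gamma s <= gamma t.

Lemma levy_small (c : R) : 0 <= c ->
  (\int[lebesgue_measure]_(s in `]c, +oo[) (gamma s `^ (- alpha))%:E < +oo)%E ->
  \forall w \ae P, forall e : R, 0 < e -> \forall t \near +oo, `|Z t w| <= e * gamma t.
Proof.
move=> c0 fin.
have [k0 fin_series] := dyadic_series_lty alpha_gt0 gamma_cont gamma_gt0 gamma_nd c0 fin.
have main (e : R) : 0 < e -> \forall w \ae P, \forall t \near +oo, `|Z t w| <= e * gamma t.
  (* The horizon is the right end of the block and the level [2 * x i] is [e * gamma] at its left
     end, so no doubling property of [gamma] is involved. *)
  move=> e0; pose T i : R := 2 ^+ (k0 + i).+1; pose x i : R := e / 2 * gamma (2 ^+ (k0 + i)).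
  have p2 n : (0 : R) < 2 ^+ n by rewrite exprn_gt0.
  have x0 i : 0 < x i by rewrite mulr_gt0 ?divr_gt0// gamma_gt0.
  pose E i := exceedance Z (T i) (2 * x i).
  have mE i : measurable (E i) by apply: (measurable_exceedance hF hZ); exact: ltW (p2 _).
  set K := tail_constant alpha * (a + `|b|).
  have K0 : 0 <= K.
    apply: mulr_ge0; first by apply: ltW; exact: tail_constant_gt0.
    by apply: addr_ge0 => //; exact: (stable_scale_ge0 hF hZ hst).
  (* Of the factor 4, one 2 comes from the maximal inequality and one from
     [T i = 2 * 2^(k0 + i)]. *)
  have PE i : (P (E i) <= (4 * K * (e / 2) `^ (- alpha))%:E *
      (2 ^+ (k0 + i) * gamma (2 ^+ (k0 + i)) `^ (- alpha))%:E)%E.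
    apply: le_trans (maximal_inequality hF hZ alpha_gt0 hst (ltW (p2 _)) (x0 i)) _.
    rewrite -EFinM lee_fin -/K /T /x exprS powRM ?divr_ge0 ?(ltW e0)//; last first.
      by rewrite ltW// gamma_gt0.
    by rewrite le_eqVlt; apply/orP; left; apply/eqP; ring.
  have E0 : P (lim_sup_set E) = 0%E.
    apply: lim_sup_set_cvg0 => //.
    apply: (@le_lt_trans _ _ (\sum_(i <oo) (4 * K * (e / 2) `^ (- alpha))%:E *
      (2 ^+ (k0 + i) * gamma (2 ^+ (k0 + i)) `^ (- alpha))%:E)%E).
      by apply: lee_nneseries => i _; rewrite ?PE.
    rewrite nneseriesZl ?lte_mul_pinfty//.
    - by rewrite lee_fin mulr_ge0 ?powR_ge0// mulr_ge0.
    - by move=> i _; rewrite lee_fin mulr_ge0 ?powR_ge0// ltW.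
  have [_ hcad _ _] := hZ.
  have hE : \forall w \ae P, ~ lim_sup_set E w.
    exists (lim_sup_set E); split => //; last by move=> w /= /contrapT.
    by apply: bigcapT_measurable => n; apply: bigcup_measurable => j _.
  apply: filterS2 hcad hE => w [_ cad] nE.
  have [n hn] : exists n, forall j, (n <= j)%N -> ~ E j w.
    apply: contrapT => h; apply: nE => n _; apply: contrapT => h2; apply: h.
    by exists n => j nj Ej; apply: h2; exists j.
  near=> t.
  have t1 : 2 ^+ (k0 + n) <= t by near: t; apply: nbhs_pinfty_ge; exact: num_real.
  have t0 : 0 < t := lt_le_trans (p2 _) t1.
  have /truncn_itv/andP[N1 N2] := ltW t0; set N := Num.truncn t in N1 N2.
  have N0 : (2 ^ (k0 + n) <= N)%N.
    by rewrite -ltnS -(ltr_nat R) natrX (le_lt_trans t1).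
  have N1' : (0 < N)%N by rewrite (leq_trans _ N0)// expn_gt0.
  have /andP[h1 h2] := trunc_log_bounds (ltnSn 1) N1'.
  set k := trunc_log 2 N in h1 h2.
  have kn : (k0 + n <= k)%N.
    by rewrite -ltnS -(ltn_exp2l _ _ (ltnSn 1)) (leq_ltn_trans N0).
  pose j := (k - k0)%N.
  have kE : k = (k0 + j)%N by rewrite /j subnKC// (leq_trans _ kn)// leq_addr.
  have nj : (n <= j)%N by rewrite -(leq_add2l k0) -kE.
  have lt1 : 2 ^+ k <= t by rewrite (le_trans _ N1)// -natrX ler_nat.
  have lt2 : t < 2 ^+ k.+1 by rewrite (lt_le_trans N2)// -natrX ler_nat.
  have := exceedance_path cad (hn j nj) (t := t); rewrite /T -kE (ltW t0) lt2 => /(_ isT) h.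
  apply: (le_trans h); rewrite /x -kE.
  have : e * gamma (2 ^+ k) <= e * gamma t by rewrite ler_wpM2l ?gamma_nd// ltW.
  lra.
(* Countably many values of [e] yield a single null set. *)
have : \forall w \ae P, forall n : nat, \forall t \near +oo, `|Z t w| <= n.+1%:R^-1 * gamma t.
  by apply/ae_foralln => n; apply: main; rewrite invr_gt0.
apply: filterS => w hw e e0.
have [n _ /(_ n (leqnn _)) /= ne] := near_infty_natSinv_lt (PosNum e0).
near=> t.
apply: (@le_trans _ _ (n.+1%:R^-1 * gamma t)); first by near: t; exact: hw.
rewrite ler_wpM2r ?(ltW ne)// ltW// gamma_gt0//.
Unshelve. all: by end_near. Qed.

Hypothesis alpha_lt2 : alpha < 2.
Hypothesis a_gt0 : 0 < a.

Lemma levy_large_increments (c : R) : 0 < c ->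
  (\int[lebesgue_measure]_(s in `]c, +oo[) (gamma s `^ (- alpha))%:E = +oo)%E ->
  \forall w \ae P, forall K : R, exists n : nat,
    K * gamma n.+1%:R <= `|Z n.+1%:R w - Z n%:R w|.
Proof.
move=> c0 inf.
have unb := unit_series_unbounded alpha_gt0 gamma_cont gamma_gt0 gamma_nd c0 inf.
have [||cc [y0 [cc0 y00 htail]]] := @tail_lower _ _ _ P (Z 1)
    (levy_measurable hF hZ ler01) alpha a b _ a_gt0.
- by rewrite alpha_gt0.
- by move=> l l0; have [-> _] := hst ler01 l0; rewrite mul1r.
have g1 : 0 < gamma 1 by exact: gamma_gt0.
have gn n : gamma 1 <= gamma n.+1%:R by rewrite gamma_nd// ler1n.
have gn0 n : 0 < gamma n.+1%:R := lt_le_trans g1 (gn n).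
(* Such a [K] puts every level [K * gamma n.+1%:R] beyond [y0], where the lower tail bound holds.
   One exceedance is enough, as [K] is arbitrarily large. *)
have main (K : R) : y0 / gamma 1 <= K ->
    \forall w \ae P, exists n : nat, K * gamma n.+1%:R <= `|Z n.+1%:R w - Z n%:R w|.
  move=> hK; have K0 : 0 < K by rewrite (lt_le_trans _ hK)// divr_gt0.
  pose xi (n : nat) := increment Z n%:R n.+1%:R.
  have nn n : (n%:R : R) <= n.+1%:R by rewrite ler_nat.
  pose A n := xi n @^-1` norm_ge (K * gamma n.+1%:R).
  pose q n := cc * K `^ (- alpha) * gamma n.+1%:R `^ (- alpha).
  have FA n : F n.+1%:R (A n).
    by apply: (increment_wrt hF hZ) => //; exact: measurable_norm_ge_set.
  have mA n : measurable (A n) by exact: (filtration_measurable hF (ler0n _ n.+1)).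
  have PA n : q n <= fine (P (A n)).
    rewrite /A /xi (increment_law hF hZ)//; last exact: measurable_norm_ge_set.
    have -> : n.+1%:R - n%:R = 1 :> R by rewrite -natr1 addrAC subrr add0r.
    rewrite /q -mulrA -powRM ?(ltW K0) ?(ltW (gn0 n))//; apply: htail.
    by rewrite (le_trans _ (_ : K * gamma 1 <= _))// ?ler_pM2l// -ler_pdivrMr.
  pose D n := \bigcap_(i in `I_n) ~` A i.
  have [hF1 hF2 _ _] := hF; have [_ _ hind _] := hZ.
  have FD n : F n%:R (D n).
    have [s0 sD sU] := (hF1 n%:R (ler0n _ n)).1.
    have -> : D n = ~` (\bigcup_(i in `I_n) A i) by rewrite setC_bigcup.
    rewrite -setTD; apply: sD; rewrite bigcup_mkcond; apply: sU => i.
    case: ifPn => // /set_mem /= ni.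
    by apply: (hF2 i.+1%:R) => //; rewrite ler_nat.
  have mD n : measurable (D n) by exact: (filtration_measurable hF (ler0n _ n)).
  (* Independence of the next increment from [F n%:R] multiplies the probability by
     [1 - P (A n) <= exp (- q n)]. *)
  have PD n : fine (P (D n)) <= expR (- \sum_(0 <= i < n) q i).
    elim: n => [|n IH].
      rewrite big_geq// oppr0 expR0 -lee_fin fine_probE//; exact: probability_le1.
    have -> : D n.+1 = D n `&` ~` A n by rewrite /D IIS bigcap_setU bigcap_set1.
    have -> : fine (P (D n `&` ~` A n)) = fine (P (D n)) * (1 - fine (P (A n))).
      have -> : P (D n `&` ~` A n) = (P (D n) * P (~` A n))%E.
        apply: (hind n%:R n.+1%:R _ _ (D n) (~` norm_ge (K * gamma n.+1%:R))) => //.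
        by apply: measurableC; exact: measurable_norm_ge_set.
      rewrite probability_setC// fineM ?fin_num_measure//; last first.
        by rewrite fin_numB fin_num_measure.
      by rewrite fineB ?fin_num_measure.
    rewrite big_nat_recr//= opprD expRD; apply: ler_pM => //.
    - exact: fine_ge0.
    - by rewrite subr_ge0 -lee_fin fine_probE//; exact: probability_le1.
    - have := expR_ge1Dx (- q n); have := PA n; lra.
  pose D' := \bigcap_n ~` A n.
  have mD' : measurable D' by apply: bigcapT_measurable => n; exact: measurableC.
  have PD' : P D' = 0%E.
    apply/eqP; rewrite -fine_probE// eqe -(rwP eqP); apply/eqP; rewrite eq_le fine_ge0// andbT.
    apply/ler_addgt0Pr => e e0; rewrite add0r.
    have k0 : 0 < cc * K `^ (- alpha) by rewrite mulr_gt0// powR_gt0.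
    have [n hn] := unb (- ln e / (cc * K `^ (- alpha))).
    apply: (@le_trans _ _ (fine (P (D n)))).
      rewrite fine_le ?fin_num_measure//; apply: le_measure; rewrite ?inE//.
      by move=> w hw i _; exact: hw.
    rewrite (le_trans (PD n))// -[leRHS](lnK (x := e)) ?posrE// ler_expR lerNl.
    by move: hn; rewrite ler_pdivrMr// mulrC mulr_sumr.
  exists D'; split => // w /= nw n _ /= An; apply: nw; exists n; exact: An.
have : \forall w \ae P, forall j : nat, exists n : nat,
    (y0 / gamma 1 + j%:R) * gamma n.+1%:R <= `|Z n.+1%:R w - Z n%:R w|.
  by apply/ae_foralln => j; apply: main; rewrite lerDl.
apply: filterS => w hw K; have [n hn] := hw (Num.truncn K).+1.
exists n; apply: le_trans hn; rewrite ler_wpM2r ?(ltW (gn0 n))//.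
have := truncnS_gt K; have : 0 < y0 / gamma 1 by rewrite divr_gt0.
lra.
Qed.
End growth_of_levy.

(** * The theorem *)

Section kernel_m_properties.
Context (R : realType) (mu : {measure set (measurableTypeR R) -> \bar R}).
Hypothesis mu_fin : (mu `[0%R, +oo[%classic < +oo)%E.

Let mu_le (A B : set (measurableTypeR R)) : measurable A -> measurable B ->
  A `<=` B -> B `<=` `[0%R, +oo[%classic -> fine (mu A) <= fine (mu B).
Proof.
move=> mA mB AB B0.
have hB : (mu B < +oo)%E.
  by apply: le_lt_trans mu_fin; apply: le_measure; rewrite ?inE.
have hAB : (mu A <= mu B)%E by apply: le_measure; rewrite ?inE.
by rewrite fine_le// ge0_fin_numE// (le_lt_trans hAB).
Qed.

Lemma kernel_m_nd : {homo kernel_m mu : s t / s <= t}.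
Proof.
move=> s t st; apply: mu_le => //.
  by apply: subset_itvl; rewrite bnd_simp.
by apply: subset_itvl; rewrite bnd_simp.
Qed.

Lemma kernel_m_ge0 (t : R) : 0 <= kernel_m mu t.
Proof. exact: fine_ge0. Qed.

Lemma kernel_m_le (t : R) : kernel_m mu t <= fine (mu `[0%R, +oo[%classic).
Proof. by apply: mu_le => //; apply: subset_itvl; rewrite bnd_simp. Qed.
End kernel_m_properties.

(** A nondecreasing [gamma] bounded by [A] would keep the integrand above the positive constant
    [A^(-alpha)] on a half-line. *)
Lemma powRN_integrable_cvgy (R : realType) (alpha c : R) (gamma : R -> R) :
  0 <= alpha -> 0 <= c -> {within `]0, +oo[, continuous gamma} ->
  (forall t : R, 0 < t -> 0 < gamma t) ->
  (forall s t : R, 0 < s -> s <= t -> gamma s <= gamma t) ->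
  (\int[lebesgue_measure]_(s in `]c, +oo[) (gamma s `^ (- alpha))%:E < +oo)%E ->
  gamma t @[t --> +oo] --> +oo.
Proof.
move=> alpha0 c0 gc g0 gnd fin.
apply/cvgryPge => A.
have [s [s0 As]] : exists s, 0 < s /\ A <= gamma s.
  apply: contrapT => nA.
  have gA s : 0 < s -> gamma s <= A.
    by move=> s0; rewrite leNgt; apply/negP => /ltW As; apply: nA; exists s.
  have A0 : 0 < A := lt_le_trans (g0 1 ltr01) (gA 1 ltr01).
  have : (\int[lebesgue_measure]_(s in `]c, +oo[) (A `^ (- alpha))%:E <=
     \int[lebesgue_measure]_(s in `]c, +oo[) (gamma s `^ (- alpha))%:E)%E.
    apply: ge0_le_integral => //.
    - by move=> s _; rewrite lee_fin powR_ge0.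
    - apply/measurable_EFinP.
      apply: (@measurable_funS _ _ _ _ `](0 : R), +oo[%classic) => //.
        by move=> s /=; rewrite !in_itv/= !andbT; exact: le_lt_trans.
      apply: (measurableT_comp (f := (@powR R ^~ (- alpha)))); first exact: measurable_powR.
      exact: subspace_continuous_measurable_fun.
    - move=> s /=; rewrite in_itv/= andbT => cs; rewrite lee_fin.
      have s0 := le_lt_trans c0 cs.
      by apply: ler_powRN => //; [exact: g0|exact: gA].
  rewrite integral_cst//= lebesgue_measure_itv/= ltry.
  rewrite addye// gt0_muley ?lte_fin ?powR_gt0// => h.
  by have := le_lt_trans h fin; rewrite ltxx.
exists s; split; first exact: num_real.
by move=> t st; rewrite (le_trans As)// gnd// ltW.
Qed.

Theorem theorem3p13 (R : realType) (d : measure_display)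
  (Omega : measurableType d) (P : probability Omega R)
  (F : R -> set (set Omega)) (hF : usual_filtration P F)
  (* a Borel measure on [0, +oo[ is a Borel measure on R carried by [0, +oo[ *)
  (mu : {measure set (measurableTypeR R) -> \bar R})
  (hmu_supp : mu `]-oo, 0%R[%classic = 0%E)
  (hmu_pos : (0 < mu `[0%R, +oo[%classic)%E) (hmu_fin : (mu `[0%R, +oo[%classic < +oo)%E)
  (alpha : R) (halpha0 : 0 < alpha) (halpha2 : alpha < 2)
  (Z : R -> Omega -> R) (hZ : levy_process P F Z)
  (hstable : alpha_stable P alpha Z) (hdrift : ~ pure_drift P Z)
  (f : R -> R) (hflip : locally_lipschitz f)
  (hfoo : f x @[x --> +oo] --> +oo)
  (phi dphi : R -> R) (hphi : C1_Rplus phi dphi)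
  (hphi_pos : forall x : R, 0 <= x -> 0 < phi x)
  (hphi_oo : phi x @[x --> +oo] --> +oo)
  (hdphi_pos : forall x : R, 0 <= x -> 0 < dphi x)
  (hdphi_mono : forall x y : R, 0 <= x -> x <= y -> dphi y <= dphi x)
  (hdphi_0 : dphi x @[x --> +oo] --> (0 : R))
  (hfphi : f x / phi x @[x --> +oo] --> (1 : R))
  (hfphi_p : `|f x| / phi `|x| @[x --> +oo] --> (1 : R))
  (hfphi_n : `|f x| / phi `|x| @[x --> -oo] --> (1 : R))
  (X0 : Omega -> R) (hX0 : measurable_wrt (F 0) X0)
  (X : R -> Omega -> R) (hX : strong_solution P F mu f X0 Z X)
  (gamma : R -> R)
  (hgamma_cont : {within `]0, +oo[, continuous gamma})
  (hgamma_pos : forall t : R, 0 < t -> 0 < gamma t)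
  (hgamma_mono : forall s t : R, 0 < s -> s <= t -> gamma s <= gamma t)
  (L : \bar R) (hL1 : (1 < L)%E)
  (hL : (gamma t / (fine (mu `[0%R, +oo[%classic) *
           \int[lebesgue_measure]_(s in `]0, t]) f (gamma s)))%:E
          @[t --> +oo] --> L) :
  (* convergence and divergence of the integral are meant at +oo; the
     integrand may be non-integrable at 0 when gamma(0+) = 0 *)
  (forall a : R, 0 <= a ->
    (\int[lebesgue_measure]_(s in `]a, +oo[) (gamma s `^ (- alpha))%:E
       < +oo)%E ->
    \forall w \ae P,
      (limf_esup (fun t : R => (`|X t w| / gamma t)%:E) (pinfty_nbhs R)
         <= L^-1)%E) /\
  (forall a : R, 0 < a ->
    (\int[lebesgue_measure]_(s in `]a, +oo[) (gamma s `^ (- alpha))%:E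
       = +oo)%E ->
    \forall w \ae P,
      limf_esup (fun t : R => (`|X t w| / gamma t)%:E) (pinfty_nbhs R)
        = +oo%E).
Proof.
set M := fine (mu `[0%R, +oo[%classic).
have M0 : 0 < M by apply: fine_gt0; rewrite hmu_pos.
have f_cont := locally_lipschitz_continuous hflip.
have f_growth := growth_bound hphi hphi_pos hdphi_pos hflip hfphi_p hfphi_n.
have phi_scale := concave_scale hphi hphi_pos hdphi_pos hdphi_mono.
have phi_affine := concave_affine hphi hphi_pos hdphi_pos hdphi_mono.
have m_nd := kernel_m_nd hmu_fin.
have m_ge0 := kernel_m_ge0 mu.
have m_le := kernel_m_le hmu_fin.
have [a [b hst]] := alpha_stable_marginals hstable.
have a0 := stable_scale_gt0 hF hZ halpha0 hst hdrift.
have [_ Xcad Xeq] := hX.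
split=> [c c0 hfin|c c0 hinf].
  have gamma_oo := powRN_integrable_cvgy (ltW halpha0) c0 hgamma_cont hgamma_pos hgamma_mono hfin.
  have Zsmall := levy_small hF hZ halpha0 hst hgamma_cont hgamma_pos hgamma_mono c0 hfin.
  apply: filterS3 Xcad Xeq Zsmall => w cadw eqw smallw.
  (* The real number [p = 1 / L] treats finite and infinite [L] alike. *)
  have [p [p0 p1 Lp hp]] : exists p : R, [/\ 0 <= p, p < 1, L^-1%E = p%:E &
      forall l : R, 1 < l -> p < l^-1 -> (l%:E < L)%E].
    case: L hL1 {hL} => [r| |//]; rewrite ?lte_fin => r1.
      have r0 : 0 < r := lt_trans ltr01 r1.
      exists r^-1; split; rewrite ?invr_ge0 ?invf_lt1 ?(ltW r0)//.
        by rewrite inver gt_eqF.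
      by move=> l l1; rewrite lte_fin ltf_pV2// posrE (lt_trans ltr01).
    by exists 0; split => // l _ _; exact: ltry.
  rewrite Lp; apply/lee_addgt0Pr => e e0.
  (* The second term keeps [q = p + e1] below 1, and [l^-1 = p + e1 / 2] lies strictly between [p]
     and [q]. *)
  pose e1 := Num.min e ((1 - p) / 2).
  have e10 : 0 < e1 by rewrite lt_min e0 divr_gt0// subr_gt0.
  have e1e : e1 <= e by rewrite ge_min lexx.
  have e1p : e1 <= (1 - p) / 2 by rewrite ge_min lexx orbT.
  pose l := (p + e1 / 2)^-1.
  have l1 : 1 < l by rewrite invf_gt1; lra.
  have lL : (l%:E < L)%E by apply: hp => //; rewrite /l invrK; lra.
  have hl := hL _ (open_ereal_gt' lL).
  have Ile : \forall t \near +oo,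
      M * (\int[lebesgue_measure]_(s in `]0, t]) f (gamma s)) <= l^-1 * gamma t.
    near=> t.
    have t0 : 0 < t by near: t; apply: nbhs_pinfty_gt; exact: num_real.
    have g0 := hgamma_pos t t0.
    have : (l%:E < (gamma t / (M * \int[lebesgue_measure]_(s in `]0, t]) f (gamma s)))%:E)%E.
      by near: t; exact: hl.
    rewrite lte_fin; set D := M * _ => h.
    (* A quotient above 1 excludes [D <= 0], including [D = 0], where division returns 0. *)
    have D0 : 0 < D.
      rewrite ltNge; apply/negP => D0.
      have : gamma t / D <= 0 by rewrite mulr_ge0_le0 ?invr_le0// ltW.
      by move: (lt_trans ltr01 (lt_trans l1 h)); lra.
    move: h; rewrite ltr_pdivlMr// => /ltW h.
    by rewrite ler_pdivlMl// (lt_trans ltr01).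
  have := pathwise_upper m_nd m_ge0 m_le f_cont hphi_pos phi_scale f_growth hgamma_cont
    hgamma_pos hgamma_mono gamma_oo hfoo hfphi M0 l1 Ile cadw eqw smallw (q := p + e1).
  rewrite /l invrK => /(_ _) h.
  have [|T [_ hT]] := h; first by apply/andP; split; lra.
  apply: (@le_trans _ _ (p + e1)%:E); last by rewrite -EFinD lee_fin lerD2l.
  apply: (@le_trans _ _ (ereal_sup [set (`|X t w| / gamma t)%:E | t in [set t | `|T| < t]])).
    apply: ereal_inf_lbound; exists [set t | `|T| < t] => //.
    by exists `|T|; split; first exact: num_real.
  apply: ge_ereal_sup => _ [t /= Tt <-]; rewrite lee_fin ler_pdivrMr.
    by apply: hT; rewrite (le_lt_trans _ Tt)// ler_norm.
  by apply: hgamma_pos; rewrite (le_lt_trans _ Tt).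
have Zlarge := levy_large_increments hF hZ halpha0 hst hgamma_cont hgamma_pos hgamma_mono
  halpha2 a0 c0 hinf.
apply: filterS3 Xcad Xeq Zlarge => w cadw eqw largew.
(* A finite limsup means a finite supremum over some neighbourhood [V] of infinity, that is, X =
   O(gamma) on this path. *)
apply/eqP; rewrite -leye_eq leNgt; apply/negP => /ereal_inf_lt[_ [V [T [_ hT]] <-]] supV.
have [K hK] : exists K : R, forall t, V t -> `|X t w| / gamma t <= K.
  move: supV; set S := ereal_sup _ => supV.
  have ubS t : V t -> ((`|X t w| / gamma t)%:E <= S)%E.
    by move=> Vt; apply: ereal_sup_ubound; exists t.
  case: S supV ubS => [r _ ubS|//|_ ubS].
    by exists r => t /ubS; rewrite lee_fin.
  by exists 0 => t /ubS; rewrite leeNy_eq.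
have [|C hC] := pathwise_increment m_nd m_ge0 m_le f_cont (hphi_pos 1 ler01) phi_affine
    f_growth hgamma_pos hgamma_mono cadw eqw (K := K) (T := `|T| + 1).
  move=> t Tt; have t0 : 0 < t by have := normr_ge0 T; lra.
  by rewrite -ler_pdivrMr ?hgamma_pos//; apply: hK; apply: hT; have := ler_norm T; lra.
(* An increment of at least [(C + 1) * gamma] contradicts the bound [C * gamma]. *)
have [n hn] := largew (C + 1).
have := le_trans hn (hC n).
by rewrite ler_pM2r ?hgamma_pos// gerDl leNgt ltr01.
Unshelve. all: by end_near. Qed.
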